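(* Let $K$ be a field of characteristic $0$ and let $k\geq 1$. Then: (i) For $n\geq 2k$, $$\gamma_n(\mathfrak{N}_{2k+1})\geq\gamma_n(\mathfrak{N}_{2k})\geq p(n),$$ where $p(n)$ is a polynomial with rational coefficients of degree $2k-2$ in $n$ with leading coefficient $\frac{2^{2k-3}}{(2k-2)!}$. (ii) $$c_n(\mathfrak{N}_{2k+1})\geq c_n(\mathfrak{N}_{2k})\geq 2^{n-1}\xi(n)+\eta(n),$$ where $\xi(n)$ and $\eta(n)$ are polynomials with rational coefficients in $n$ such that $\deg\xi(n)=2k-2$, $\deg\eta(n)\leq 2k-1$, and the leading term (i.e., leading coefficient) of $\xi(n)$ is equal to $((2k-2)!)^{-1}$. Furthermore, for $n\leq 4k$, $c_n(\mathfrak{N}_{2k+1})$ (respectively, $\gamma_n(\mathfrak{N}_{2k+1})$) is strictly bigger than $c_n(\mathfrak{N}_{2k})$ (respectively, $\gamma_n(\mathfrak{N}_{2k})$).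
   Context: $K\langle X\rangle$ is the free unital associative $K$-algebra on $X=\{x_1,x_2,\dots\}$ and $K\langle X_n\rangle$ the free unital subalgebra generated by $x_1,\dots,x_n$. Commutators are left-normed: $[u_1,u_2]=u_1u_2-u_2u_1$, $[u_1,\dots,u_{m+1}]=[[u_1,\dots,u_m],u_{m+1}]$. $I_{p+1}$ is the two-sided ideal of $K\langle X\rangle$ generated by all commutators $[u_1,\dots,u_{p+1}]$, $u_i\in K\langle X\rangle$. $\mathfrak{N}_p$ is the variety of unital associative $K$-algebras satisfying $[x_1,\dots,x_{p+1}]=0$, and $F_n(\mathfrak{N}_p)=K\langle X_n\rangle/(I_{p+1}\cap K\langle X_n\rangle)$. $P_n\subset K\langle X_n\rangle$ is the space of multilinear polynomials of degree $n$ in $x_1,\dots,x_n$, and $\Gamma_n\subset P_n$ the subspace of proper ones, i.e. linear combinations of products of commutators (of length at least $2$) whose entries are variables. $P_n(\mathfrak{N}_p)$ and $\Gamma_n(\mathfrak{N}_p)$ are their images in $F_n(\mathfrak{N}_p)$. Set $c_n(\mathfrak{N}_p)=\dim P_n(\mathfrak{N}_p)$ and $\gamma_n(\mathfrak{N}_p)=\dim\Gamma_n(\mathfrak{N}_p)$.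
   Formalization: For k=1 the bound γ_n ≥ p(n) is stated only for even n (for odd n ≥ 3, γ_n(N_2)=0 < 1/2 = p), and the strict inequalities are stated only for 2k < n ≤ 4k (for n ≤ 2k the two codimensions, and the two proper ones, coincide). *)

(* Defs.v *)
From mathcomp Require Import all_boot all_algebra finmap.
From mathcomp Require Import boolp classical_sets.
From mathcomp.multinomials Require Import monalg.

Set Implicit Arguments.
Unset Strict Implicit.
Unset Printing Implicit Defensive.

Import GRing.Theory.

Local Open Scope classical_set_scope.
Local Open Scope ring_scope.

Section Generic.
Variables (K : fieldType) (V : lmodType K).

Definition lspan (S : set V) : set V :=
  [set f | exists (N : nat) (c : 'I_N -> K) (g : 'I_N -> V),
     (forall i, S (g i)) /\ f = \sum_i c i *: g i].

(* d is the dimension of the image of the subspace U in V / W: the v_i are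
   elements of U whose classes form a basis of (U + W) / W. *)
Definition is_dim_mod (U W : set V) (d : nat) : Prop :=
  exists v : 'I_d -> V,
    [/\ forall i, U (v i),
        forall c : 'I_d -> K, W (\sum_i c i *: v i) -> forall i, c i = 0
      & forall u, U u -> exists c : 'I_d -> K, W (u - \sum_i c i *: v i)].

(* For subspaces U and W such a d is unique; the default value 0 is only used
   when the image is infinite dimensional, which never happens for spaces of
   multilinear polynomials of a fixed degree. *)
Definition dim_mod (U W : set V) : nat := xget 0%N [set d | is_dim_mod U W d].

End Generic.

Section Ring.
Variable A : nzRingType.

Definition ideal_gen (S : set A) : set A :=
  [set f | exists (N : nat) (a g b : 'I_N -> A),
     (forall i, S (g i)) /\ f = \sum_i a i * g i * b i].

Definition comm (u v : A) : A := u * v - v * u.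

(* [u_1, ..., u_m] = [...[[u_1, u_2], u_3], ..., u_m] *)
Definition lncomm (us : seq A) : A :=
  if us is u :: s then foldl comm u s else 0.

End Ring.

(* The variable x_(i+1) is the letter i : nat; the words in these letters are
   the elements of {fmonom nat}. *)
Notation free_alg K := {malg K[{fmonom nat}]}.

Section FreeAlgebra.
Variable K : fieldType.

Definition var (i : nat) : free_alg K := << fmu i >>.

(* K<X_n> *)
Definition subalg (n : nat) : set (free_alg K) :=
  [set f | forall m : {fmonom nat}, m \in msupp f -> all (fun i => i < n)%N m].

(* I_q *)
Definition comm_ideal (q : nat) : set (free_alg K) :=
  ideal_gen [set lncomm us | us in [set us : seq (free_alg K) | size us = q]].

(* P_n *)
Definition multilinear (n : nat) : set (free_alg K) :=
  [set f | forall m : {fmonom nat}, m \in msupp f -> perm_eq m (iota 0 n)].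

(* The empty product is allowed, so 1 is proper. *)
Definition proper : set (free_alg K) :=
  lspan [set f | exists ss : seq (seq nat),
    all (fun s => 2 <= size s)%N ss /\ f = \prod_(s <- ss) lncomm (map var s)].

(* Gamma_n *)
Definition proper_multilinear (n : nat) : set (free_alg K) :=
  multilinear n `&` proper.

(* I_(p+1) `&` K<X_n>, so that F_n(N_p) = K<X_n> / lie_nilp_ids p n *)
Definition lie_nilp_ids (p n : nat) : set (free_alg K) :=
  comm_ideal p.+1 `&` subalg n.

End FreeAlgebra.

(* c_n(N_p) *)
Definition codim (K : fieldType) (p n : nat) : nat :=
  dim_mod (@multilinear K n) (@lie_nilp_ids K p n).

(* gamma_n(N_p) *)
Definition proper_codim (K : fieldType) (p n : nat) : nat :=
  dim_mod (@proper_multilinear K n) (@lie_nilp_ids K p n).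

(* Main.v *)
(* Lower bounds.  Let E be the Grassmann algebra and E_r the one on r generators.
   For r = 2k-2 the tensor product of E and E_r lies in N_(2k): on words, the
   functional "coefficient of the product of all generators" turns a commutator
   of words into a product of factors 1 -/+ 1, governed by a symmetric bilinear
   form on parities in (Z/2)^2, and at most r entries of a commutator can be odd
   for the second factor, which forces length at most r + 2.  Such functionals
   are indexed by the parities of the letters, i.e. by the set S of the r letters
   odd for the second factor and the subset Z of S of those odd for both; when
   |Z| = n mod 2 they are triangular with respect to products of one long
   commutator [x, z_1, ..., z_m, b] (which forces the z_i into Z), of factors
   [p,q][s,t] + [p,s][q,t] (which force p and q into S) and of commutators of
   length 2.  There are 2^(r-1) C(n - 2k, r) such pairs (S, Z) when r > 0.
   Restricting to the letters of a subset T of {1..n} and multiplying by the other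
   letters turns this into a bound for c_n.

   Strictness.  For n = l + 2k with 1 <= l <= 2k, the commutator
   [x_1 ... x_l, x_(l+1), ..., x_n] has length 2k + 1.  In the Weyl algebra a
   commutator of length 2k + 2 in which d/dt occurs 2k times vanishes because
   commutation with a differential operator lowers the order, whereas the
   commutator above is a nonzero constant for suitable x_1, ..., x_l in K[t] and
   x_(l+1) = ... = x_n = d/dt. *)
From HB Require Import structures.
Require Import Defs.
From mathcomp Require Import all_boot all_order all_algebra finmap.
From mathcomp Require Import boolp.
From mathcomp Require classical_sets.
From mathcomp.multinomials Require Import monalg.
From mathcomp Require Import zify ring lra.

Set Implicit Arguments.
Unset Strict Implicit.
Unset Printing Implicit Defensive.

Import Order.TTheory GRing.Theory Num.Theory.
Local Open Scope ring_scope.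

(** * Dimensions modulo a subspace *)

Section DimMod.
Variables (K : fieldType) (V : lmodType K).
Implicit Types (U W : V -> Prop).

Definition subspace W := W 0 /\ forall c u v, W u -> W v -> W (c *: u + v).

Lemma subspaceD W u v : subspace W -> W u -> W v -> W (u + v).
Proof. by move=> [_ cl] Wu Wv; rewrite -[u]scale1r; apply: cl. Qed.

Lemma subspaceZ W c u : subspace W -> W u -> W (c *: u).
Proof. by move=> [W0 cl] Wu; rewrite -[_ *: _]addr0; apply: cl. Qed.

Lemma subspaceB W u v : subspace W -> W u -> W v -> W (u - v).
Proof. by move=> sW Wu Wv; rewrite addrC -scaleN1r; apply: sW.2. Qed.

Lemma subspace_sum W I (r : seq I) (P : pred I) (F : I -> V) :
  subspace W -> (forall i, P i -> W (F i)) -> W (\sum_(i <- r | P i) F i).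
Proof.
move=> sW WF; elim/big_ind: _ => //; first exact: sW.1.
by move=> *; apply: subspaceD.
Qed.

Definition free_mod W d (v : 'I_d -> V) :=
  forall c : 'I_d -> K, W (\sum_i c i *: v i) -> forall i, c i = 0.

Definition in_span_mod W d (v : 'I_d -> V) (u : V) :=
  exists c : 'I_d -> K, W (u - \sum_i c i *: v i).

(** If [b < a], the [a] by [b] matrix of coordinates of the [v i] has a nonzero row vector in its
    left kernel, which is a dependency of the [v i] modulo [W]. *)
Lemma free_mod_leq W a b (v : 'I_a -> V) (w : 'I_b -> V) :
  subspace W -> free_mod W v -> (forall i, in_span_mod W w (v i)) -> (a <= b)%N.
Proof.
move=> sW frv spv; have [M WM] := choice spv.
pose A := \matrix_(i, j) M i j.
rewrite leqNgt; apply/negP => ltba.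
have: kermx A != 0.
  rewrite -mxrank_eq0 mxrank_ker -lt0n subn_gt0.
  exact: leq_ltn_trans (rank_leq_col A) ltba.
case/rowV0Pn => c /sub_kermxP cA0 /eqP; apply; apply/rowP => i; rewrite mxE.
apply: (frv (fun i => c 0 i)); pose y := \sum_i c 0 i *: (v i - \sum_j M i j *: w j).
suff -> : \sum_i c 0 i *: v i = y.
  by apply: subspace_sum => // j _; apply: subspaceZ.
rewrite /y; under [RHS]eq_bigr do rewrite scalerBr.
rewrite sumrB -[LHS]subr0; congr (_ - _); symmetry.
under eq_bigr do rewrite scaler_sumr; rewrite exchange_big big1 //= => j _.
under eq_bigr do rewrite scalerA; rewrite -scaler_suml.
have -> : \sum_i c 0 i * M i j = 0; last by rewrite scale0r.
have /rowP/(_ j) := cA0; rewrite !mxE => e.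
by rewrite -[RHS]e; apply: eq_bigr => k _; rewrite mxE.
Qed.

(** A free family in [U] has at most [N] members, and one of maximal size spans: otherwise a missed
    vector could be adjoined to it. *)
Lemma is_dim_mod_exists U W N (g : 'I_N -> V) :
  subspace W -> (forall u, U u -> in_span_mod W g u) ->
  exists d, is_dim_mod U W d.
Proof.
move=> sW Ug.
pose P d := `[< exists v : 'I_d -> V, (forall i, U (v i)) /\ free_mod W v >].
have P0 : exists d, P d.
  exists 0%N; apply/asboolP; exists (fun=> 0); split; first by case.
  by move=> c _; case.
have Pb d : P d -> (d <= N)%N.
  by move=> /asboolP[v [Uv fv]]; apply: (free_mod_leq sW fv) => i; apply: Ug.
case: (ex_maxnP P0 Pb) => d /asboolP[v [Uv fv]] dmax.
exists d, v; split=> // u Uu; apply: contrapT => nspan.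
suff /dmax : P d.+1 by rewrite ltnn.
apply/asboolP; exists (fun i => if unlift ord0 i is Some j then v j else u).
split=> [i|c]; first by case: unliftP.
rewrite big_ord_recl unlift_none; under eq_bigr do rewrite liftK.
move=> Wc; have c0 : c ord0 = 0.
  apply: contrapT => /eqP c0; apply: nspan.
  exists (fun i => - ((c ord0)^-1 * c (lift ord0 i))).
  under eq_bigr do rewrite scaleNr -scalerA.
  rewrite sumrN opprK -scaler_sumr -[u]scale1r -(mulVf c0) -scalerA -scalerDr.
  exact: subspaceZ.
move=> i; case: (unliftP ord0 i) => [j ->|->] //.
by apply: (fv (fun j => c (lift ord0 j))); move: Wc; rewrite c0 scale0r add0r.
Qed.

Lemma dim_modP U W N (g : 'I_N -> V) :
  subspace W -> (forall u, U u -> in_span_mod W g u) ->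
  is_dim_mod U W (dim_mod U W).
Proof. by move=> sW Ug; apply: classical_sets.xgetPex; exact: (is_dim_mod_exists sW Ug). Qed.

Lemma free_mod_leq_dim U W N (g : 'I_N -> V) d (v : 'I_d -> V) :
  subspace W -> (forall u, U u -> in_span_mod W g u) ->
  (forall i, U (v i)) -> free_mod W v -> (d <= dim_mod U W)%N.
Proof.
move=> sW Ug Uv fv; have [w [Uw fw spw]] := dim_modP sW Ug.
by apply: (free_mod_leq sW fv) => i; apply: spw.
Qed.

Lemma in_span_modS W W' N (g : 'I_N -> V) u :
  (forall x, W' x -> W x) -> in_span_mod W' g u -> in_span_mod W g u.
Proof. by move=> sub [c /sub Wc]; exists c. Qed.

Lemma dim_modS U W W' N (g : 'I_N -> V) :
  subspace W -> subspace W' -> (forall x, W' x -> W x) ->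
  (forall u, U u -> in_span_mod W' g u) -> (dim_mod U W <= dim_mod U W')%N.
Proof.
move=> sW sW' sub Ug.
have [v [Uv fv _]] := dim_modP sW (fun u Uu => in_span_modS sub (Ug u Uu)).
by apply: (free_mod_leq_dim sW' Ug Uv) => c /sub; apply: fv.
Qed.

(** A basis modulo [W] stays free modulo [W'] once [x] is adjoined: a relation modulo [W'] holds
    modulo [W], where [x] vanishes, so only the coefficient of [x] can survive, and [x] is not in
    [W']. *)
Lemma dim_mod_lt U W W' N (g : 'I_N -> V) x :
  subspace W -> subspace W' -> (forall y, W' y -> W y) ->
  (forall u, U u -> in_span_mod W' g u) ->
  U x -> W x -> ~ W' x -> (dim_mod U W < dim_mod U W')%N.
Proof.
move=> sW sW' sub Ug Ux Wx nW'x.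
have [v [Uv fv _]] := dim_modP sW (fun u Uu => in_span_modS sub (Ug u Uu)).
pose w (i : 'I_(dim_mod U W).+1) := if unlift ord0 i is Some j then v j else x.
apply: (free_mod_leq_dim sW' Ug (v := w)) => [i|c].
  by rewrite /w; case: unliftP.
rewrite big_ord_recl /w unlift_none; under eq_bigr do rewrite liftK.
move=> W'c; have cl j : c (lift ord0 j) = 0.
  apply: (fv (fun j => c (lift ord0 j))).
  rewrite -[\sum_i _](addKr (c ord0 *: x)) addrC.
  by apply: subspaceB => //; [apply: sub | apply: subspaceZ].
move=> i; case: (unliftP ord0 i) => [j ->|->] //.
apply: contrapT => /eqP c0; apply: nW'x.
rewrite -[x]scale1r -(mulVf c0) -scalerA; apply: subspaceZ => //.
by move: W'c; rewrite [X in _ + X]big1 ?addr0 // => j _; rewrite cl scale0r.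
Qed.

(** The matrix [phi i (v j)] is triangular for [ht] with nonzero diagonal, so the coefficients of a
    relation modulo [W] vanish by induction on [ht]. *)
Lemma triangular_leq_dim (I : finType) U W N (g : 'I_N -> V)
    (v : I -> V) (phi : I -> {linear V -> K^o}) (ht : I -> nat) :
  subspace W -> (forall u, U u -> in_span_mod W g u) ->
  (forall i, U (v i)) -> (forall i w, W w -> phi i w = 0) ->
  (forall i, phi i (v i) != 0) ->
  (forall i j, phi i (v j) != 0 -> i != j -> (ht j < ht i)%N) ->
  (#|I| <= dim_mod U W)%N.
Proof.
move=> sW Ug Uv phiW phid tri.
apply: (free_mod_leq_dim sW Ug (v := fun k => v (enum_val k))) => // c Wc.
suff cht m k : (ht (enum_val k) < m)%N -> c k = 0 by move=> k; apply: cht (ltnSn _).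
elim: m k => // m IH k; rewrite ltnS => htk.
have := phiW (enum_val k) _ Wc; rewrite linear_sum (bigD1 k) //= big1 => [|l lk].
  by rewrite addr0 linearZ => /eqP; rewrite mulf_eq0 (negbTE (phid _)) orbF => /eqP.
rewrite linearZ /=; have [-> |nz] := eqVneq (phi (enum_val k) (v (enum_val l))) 0.
  exact: scaler0.
rewrite IH ?scale0r //; apply: leq_trans htk; apply: tri => //.
by rewrite (inj_eq enum_val_inj) eq_sym.
Qed.

End DimMod.

(** * The free algebra *)

Section CommutatorRing.
Variable A : nzRingType.
Implicit Types f g h v : A.

Lemma comm_mul f g h : comm (f * g) h = f * comm g h + comm f h * g.
Proof. by rewrite /comm mulrBr mulrBl !mulrA addrA subrK. Qed.

(** The left side is [f * v * g] minus [v] times the result of setting the bare factor [v] to 1;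
    this is how [proj] turns a bare letter into a commutator. *)
Lemma comm_pull f g v : f * v * g - v * (f * g) = comm f v * g.
Proof. by rewrite /comm mulrBl !mulrA. Qed.

Lemma comm0l h : comm 0 h = 0. Proof. by rewrite /comm mul0r mulr0 subrr. Qed.
Lemma comm0r h : comm h 0 = 0. Proof. by rewrite /comm mul0r mulr0 subrr. Qed.
Lemma comm1l h : comm 1 h = 0. Proof. by rewrite /comm mul1r mulr1 subrr. Qed.
Lemma comm1r h : comm h 1 = 0. Proof. by rewrite /comm mul1r mulr1 subrr. Qed.

Lemma foldl_comm0 (s : seq A) : foldl (@comm A) 0 s = 0.
Proof. by elim: s => //= h s; rewrite comm0l. Qed.

Lemma lncomm_has1 (s : seq A) : (1 < size s)%N -> 1 \in s -> lncomm s = 0.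
Proof.
case: s => [|f [|g s]] //= _; rewrite !inE => /or3P[/eqP <-|/eqP <-|].
- by rewrite comm1l foldl_comm0.
- by rewrite comm1r foldl_comm0.
elim: s (comm f g) => //= h s IH x; rewrite inE => /orP[/eqP <-|/IH -> //].
by rewrite comm1r foldl_comm0.
Qed.

Lemma lncomm_rcons (s : seq A) h : s != [::] -> lncomm (rcons s h) = comm (lncomm s) h.
Proof. by case: s => //= f s _; rewrite -cats1 foldl_cat. Qed.

Lemma lncomm_morph (phi : A -> A) (s : seq A) :
  (forall f g, phi (comm f g) = comm (phi f) (phi g)) -> phi 0 = 0 ->
  phi (lncomm s) = lncomm (map phi s).
Proof.
move=> phic phi0; case: s => //= f s.
by elim: s f => //= g s IH f; rewrite IH phic.
Qed.

End CommutatorRing.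

Section Words.
Variable K : fieldType.
Local Notation A := (free_alg K).
Implicit Types (f g h : A) (u v w : seq nat).

Definition word w : A := << FMonom w >>.

Lemma word_nil : word [::] = 1.
Proof. by rewrite /word -fmoneE. Qed.

Lemma word_cat u v : word (u ++ v) = word u * word v.
Proof.
rewrite malgM_def /word fgmulUU mulr1; congr << _ >>.
by apply/val_inj; rewrite /= fmM.
Qed.

Lemma word1 x : word [:: x] = var K x.
Proof. by rewrite /word /var fmuE. Qed.

Lemma scale_malgU c a (m : {fmonom nat}) : c *: << a *g m >> = << c * a *g m >> :> A.
Proof. by apply/malgP => m'; rewrite mcoeffZ !mcoeffU mulrnAr. Qed.

Lemma malg_word_ind (P : A -> Prop) :
  (forall w, P (word w)) -> subspace P -> forall f, P f.
Proof.
move=> Pw sP f; rewrite (monalgE f).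
apply: subspace_sum => // -[w] _; rewrite -[f@__]mulr1 -scale_malgU.
exact: (subspaceZ _ sP (Pw w)).
Qed.

(* The library equips {malg K[M]} with a left algebra structure only. *)
Lemma malg_scalerAr c f g : c *: (f * g) = f * (c *: g).
Proof.
rewrite (malgMEw (fsubset_refl _) (msuppZ_le c g)) malgME scaler_sumr.
apply: eq_bigr => m _; rewrite scaler_sumr; apply: eq_bigr => m' _.
by rewrite scale_malgU mcoeffZ mulrCA.
Qed.

Definition lmull f g := f * g.
Definition lmulr f g := g * f.

Lemma lmull_is_linear f : linear (lmull f).
Proof. by move=> c g h; rewrite /lmull mulrDr malg_scalerAr. Qed.
HB.instance Definition _ f := GRing.isLinear.Build K A A _ (lmull f) (lmull_is_linear f).

Lemma lmulr_is_linear f : linear (lmulr f).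
Proof. by move=> c g h; rewrite /lmulr mulrDl scalerAl. Qed.
HB.instance Definition _ f := GRing.isLinear.Build K A A _ (lmulr f) (lmulr_is_linear f).

Section LinearExtension.
Variables (V : lmodType K) (F : seq nat -> V).

Definition lext f : V := \sum_(m <- msupp f) f@_m *: F m.

(** A larger index set lets the sums for [f], [g] and [c *: f + g] in the linearity proof run over
    one common set. *)
Lemma lextEw (d : {fset {fmonom nat}}) f :
  (msupp f `<=` d)%fset -> lext f = \sum_(m <- d) f@_m *: F m.
Proof.
move=> le; apply: big_fset_incl => // m _ /mcoeff_outdom ->.
by rewrite scale0r.
Qed.

Lemma lext_is_linear : linear lext.
Proof.
move=> c f g; pose d := (msupp f `|` msupp g `|` msupp (c *: f + g))%fset.
have df : (msupp f `<=` d)%fset by rewrite /d -fsetUA fsubsetUl.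
have dg : (msupp g `<=` d)%fset by rewrite /d fsetUAC fsubsetUr.
rewrite !(@lextEw d) ?fsubsetUr //.
rewrite scaler_sumr -big_split /=; apply: eq_bigr => m _.
by rewrite mcoeffD mcoeffZ scalerDl scalerA.
Qed.
HB.instance Definition _ := GRing.isLinear.Build K A V _ lext lext_is_linear.

Lemma lext_word w : lext (word w) = F w.
Proof. by rewrite /lext msuppU1 big_seq_fset1 mcoeffUU scale1r. Qed.

End LinearExtension.

Lemma linear_eq0_subspace (V : lmodType K) (phi : {linear A -> V}) :
  subspace (fun f => phi f = 0).
Proof.
split=> [|c f g f0 g0]; first exact: linear0.
by rewrite linearP f0 g0 scaler0 addr0.
Qed.

Lemma linear_word_eq (V : lmodType K) (phi psi : {linear A -> V}) :
  (forall w, phi (word w) = psi (word w)) -> phi =1 psi.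
Proof.
move=> e f; apply/eqP; rewrite -subr_eq0; apply/eqP; move: f.
apply: malg_word_ind => [w|]; first by rewrite e subrr.
split=> [|c f g f0 g0]; first by rewrite (linear0 phi) (linear0 psi) subrr.
by rewrite (linearP phi) (linearP psi) opprD addrACA -scalerBr f0 g0 scaler0 addr0.
Qed.

Lemma commDZl c f g h : comm (c *: f + g) h = c *: comm f h + comm g h.
Proof. by rewrite /comm mulrDl mulrDr -malg_scalerAr -scalerAl opprD addrACA scalerBr. Qed.

Lemma commDZr c f g h : comm h (c *: f + g) = c *: comm h f + comm h g.
Proof. by rewrite /comm mulrDl mulrDr -malg_scalerAr -scalerAl opprD addrACA scalerBr. Qed.

Lemma foldl_commDZ c f g (s : seq A) :
  foldl (@comm A) (c *: f + g) s = c *: foldl (@comm A) f s + foldl (@comm A) g s.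
Proof. by elim: s f g => //= h s IH f g; rewrite commDZl IH. Qed.

Lemma lncommDZ c f g (s t : seq A) :
  lncomm (s ++ (c *: f + g) :: t) = c *: lncomm (s ++ f :: t) + lncomm (s ++ g :: t).
Proof.
case: s => [|h s]; first exact: foldl_commDZ.
by rewrite /= !foldl_cat /= commDZr; exact: foldl_commDZ.
Qed.

Lemma lncomm0 (s t : seq A) : lncomm (s ++ 0 :: t) = 0.
Proof.
by case: s => [|h s] /=; rewrite ?foldl_cat /= ?comm0r foldl_comm0.
Qed.

Lemma lncomm_words_ind (P : A -> Prop) q : subspace P ->
  (forall ws : seq (seq nat), size ws = q -> P (lncomm (map word ws))) ->
  forall us : seq A, size us = q -> P (lncomm us).
Proof.
(* Entries are replaced by words from left to right: [ws] is the part already treated, [us'] the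
   part still arbitrary. *)
move=> sP Pw us sz; suff gen us' (ws : seq (seq nat)) :
    size (map word ws ++ us') = q -> P (lncomm (map word ws ++ us')).
  exact: (gen us [::]).
elim: us' ws => [|u us' IH] ws.
  by rewrite cats0 size_map; apply: Pw.
move: u; apply: (@malg_word_ind (fun x =>
    size (map word ws ++ x :: us') = q -> P (lncomm (map word ws ++ x :: us')))).
  move=> w; rewrite -cat_rcons -map_rcons; exact: IH.
split=> [_|c f g Pf Pg sz']; first by rewrite lncomm0; exact: sP.1.
rewrite lncommDZ; apply: sP.2; [apply: Pf | apply: Pg];
  by rewrite -sz' !size_cat.
Qed.

Lemma comm_ideal_subspace q : subspace (comm_ideal (K := K) q).
Proof.
split=> [|c f g].
  by exists 0%N, (fun=> 0), (fun=> 0), (fun=> 0); split=> [[]//|]; rewrite big_ord0.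
move=> [M [a [b [d [Sb ->]]]]] [N [a' [b' [d' [Sb' ->]]]]].
pose glue (T : Type) (x : 'I_M -> T) (y : 'I_N -> T) (i : 'I_(M + N)) :=
  match split i with inl j => x j | inr j => y j end.
exists (M + N)%N, (glue _ (fun i => c *: a i) a'), (glue _ b b'), (glue _ d d'); split.
  by move=> i; rewrite /glue; case: split.
rewrite big_split_ord scaler_sumr /glue.
apply: (congr2 (fun x y => x + y)); apply: eq_bigr => i _.
  by rewrite -[lshift _ _]/(unsplit (inl i)) unsplitK !scalerAl.
by rewrite -[rshift _ _]/(unsplit (inr i)) unsplitK.
Qed.

Lemma comm_ideal_gen q f (us : seq A) g :
  size us = q -> comm_ideal q (f * lncomm us * g).
Proof.
move=> sz; exists 1%N, (fun=> f), (fun=> lncomm us), (fun=> g).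
by split=> [_|]; [exists us | rewrite big_ord1].
Qed.

Lemma comm_ideal_ind (P : A -> Prop) q : subspace P ->
  (forall f us g, size us = q -> P (f * lncomm us * g)) ->
  forall f, comm_ideal q f -> P f.
Proof.
move=> sP Pg f [N [a [b [d [Sb ->]]]]]; apply: subspace_sum => // i _.
by have [us sz <-] := Sb i; apply: Pg.
Qed.

Lemma comm_idealM q f g h : comm_ideal q g -> comm_ideal q (f * g * h).
Proof.
move: g; apply: comm_ideal_ind => [|a us b sz].
  split=> [|c x y]; first by rewrite mulr0 mul0r; exact: (comm_ideal_subspace q).1.
  by rewrite mulrDr mulrDl -malg_scalerAr -scalerAl; exact: (comm_ideal_subspace q).2.
by rewrite !mulrA -[_ * b * h]mulrA; exact: comm_ideal_gen.
Qed.

(** The innermost commutator of the first two entries is taken as a single entry. *)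
Lemma comm_idealS q f : (0 < q)%N -> comm_ideal q.+1 f -> comm_ideal q f.
Proof.
case: q => // q _; apply: comm_ideal_ind => [|a us b]; first exact: comm_ideal_subspace.
case: us => // u [|v us] // [sz]; apply: (@comm_ideal_gen _ _ (comm u v :: us)).
by rewrite /= sz.
Qed.

(* By multilinearity, only commutators of words need to be tested. *)
Lemma comm_ideal_kill (V : lmodType K) (phi : {linear A -> V}) q :
  (forall u ws v, size ws = q -> phi (word u * lncomm (map word ws) * word v) = 0) ->
  forall f, comm_ideal q f -> phi f = 0.
Proof.
move=> kill; apply: comm_ideal_ind; first exact: linear_eq0_subspace.
move=> f us g; move: us; apply: (@lncomm_words_ind (fun h => phi (f * h * g) = 0)).
  exact: (linear_eq0_subspace (phi \o lmulr g \o lmull f)).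
move=> ws sz; move: f; apply: malg_word_ind; last first.
  exact: (linear_eq0_subspace (phi \o lmulr g \o lmulr (lncomm (map word ws)))).
move=> u; move: g; apply: malg_word_ind; last first.
  exact: (linear_eq0_subspace (phi \o lmull _)).
by move=> v; apply: kill.
Qed.

Definition supp_in (P : pred (seq nat)) f :=
  forall m : {fmonom nat}, m \in msupp f -> P m.

Lemma supp_in_subspace P : subspace (supp_in P).
Proof.
split=> [m|c f g Pf Pg m]; first by rewrite msupp0.
move=> /(fsubsetP (msuppD_le _ _)); rewrite in_fsetU => /orP[]; last exact: Pg.
by move=> /(fsubsetP (msuppZ_le _ _)); apply: Pf.
Qed.

Lemma supp_in_word (P : pred (seq nat)) w : P w -> supp_in P (word w).
Proof. by move=> Pw m; rewrite msuppU1 in_fset1 => /eqP->. Qed.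

Lemma supp_inM (P Q R : pred (seq nat)) f g :
  (forall u v, P u -> Q v -> R (u ++ v)) ->
  supp_in P f -> supp_in Q g -> supp_in R (f * g).
Proof.
move=> PQR Pf Qg m /msuppM_le[m1 [m2 [/Pf P1 /Qg Q2 ->]]].
by rewrite fmM; apply: PQR.
Qed.

Lemma supp_in_perm w w' f :
  perm_eq w w' -> supp_in (perm_eq w) f -> supp_in (perm_eq w') f.
Proof. by move=> pw Pf m /Pf; apply: perm_trans; rewrite perm_sym. Qed.

Lemma supp_in_permM u v f g :
  supp_in (perm_eq u) f -> supp_in (perm_eq v) g -> supp_in (perm_eq (u ++ v)) (f * g).
Proof. by apply: supp_inM => x y; apply: perm_cat. Qed.

Lemma supp_in_perm_comm u v f g :
  supp_in (perm_eq u) f -> supp_in (perm_eq v) g -> supp_in (perm_eq (u ++ v)) (comm f g).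
Proof.
move=> uf vg; apply: (subspaceB (supp_in_subspace _)); first exact: supp_in_permM.
by apply: (@supp_in_perm (v ++ u)); [rewrite perm_catC | apply: supp_in_permM].
Qed.

Lemma supp_in_perm_lncomm (ws : seq (seq nat)) :
  supp_in (perm_eq (flatten ws)) (lncomm (map word ws)).
Proof.
case: ws => [|w ws] /=; first exact: (supp_in_subspace _).1.
suff go s f : supp_in (perm_eq s) f ->
    supp_in (perm_eq (s ++ flatten ws)) (foldl (@comm A) f (map word ws)).
  exact/go/supp_in_word.
elim: ws s f => [|v ws IH] s f sf /=; first by rewrite cats0.
by rewrite catA; apply: IH; apply: supp_in_perm_comm => //; apply: supp_in_word.
Qed.

Lemma multilinearP n f : multilinear n f <-> supp_in (perm_eq (iota 0 n)) f.
Proof. by split=> Pf m /Pf; rewrite perm_sym. Qed.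

Lemma multilinear_subspace n : subspace (multilinear (K := K) n).
Proof.
split=> [|c f g]; rewrite !multilinearP; first exact: (supp_in_subspace _).1.
exact: (supp_in_subspace _).2.
Qed.

Lemma lie_nilp_ids_subspace p n : subspace (lie_nilp_ids (K := K) p n).
Proof.
split=> [|c f g [If Sf] [Ig Sg]]; split; first exact: (comm_ideal_subspace _).1.
- exact: (supp_in_subspace (all _)).1.
- exact: (comm_ideal_subspace _).2.
- exact: (supp_in_subspace (all _)).2.
Qed.

Lemma multilinear_lie_nilp_ids p n f :
  multilinear n f -> comm_ideal p.+1 f -> lie_nilp_ids p n f.
Proof.
move=> mf If; split=> // m /mf pm; apply/allP => x.
by rewrite (perm_mem pm) mem_iota.
Qed.

(** The permutations of the letters form a finite spanning family, which makes every [dim_mod] below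
    a genuine dimension. *)
Lemma multilinear_in_span_mod p n f : multilinear n f ->
  in_span_mod (lie_nilp_ids p n)
    (fun i : 'I_(size (permutations (iota 0 n))) =>
       word (nth [::] (permutations (iota 0 n)) i)) f.
Proof.
move=> mf; set s := permutations _.
exists (fun i : 'I_(size s) => f@_(FMonom (nth [::] s i))).
suff e : \sum_(i < size s) f@_(FMonom (nth [::] s i)) *: word (nth [::] s i) = f.
  by rewrite e subrr; exact: (lie_nilp_ids_subspace _ _).1.
rewrite -(big_mkord xpredT (fun i => f@_(FMonom (nth [::] s i)) *: word (nth [::] s i))).
rewrite -(big_nth [::] xpredT (fun w => f@_(FMonom w) *: word w)).
rewrite [RHS]monalgE; under eq_bigr do rewrite scale_malgU mulr1.
rewrite -(big_map (@FMonom nat) xpredT (fun m => << f@_m *g m >>)).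
rewrite (bigID (fun m => m \in msupp f)) /= [X in _ + X]big1 => [|m]; last first.
  by rewrite -mcoeff_eq0 => /eqP ->; rewrite monalgU0.
rewrite addr0 -big_filter; apply: perm_big; apply: uniq_perm.
- rewrite filter_uniq // map_inj_uniq ?permutations_uniq //.
  by move=> x y [].
- exact: fset_uniq.
move=> m; rewrite mem_filter andb_idr // => mf'.
by apply/mapP; exists (m : seq nat); [rewrite mem_permutations; apply: mf | case: m {mf'}].
Qed.

End Words.

(** * Sign functionals *)

(** Degrees in (Z/2)^2: the first component is the parity in E, the second the parity in E_r. *)
Definition parity : Type := bool * bool.
Definition padd (s t : parity) : parity := (s.1 (+) t.1, s.2 (+) t.2).
(** The exponent of the sign by which homogeneous elements of degrees [s] and [t] commute in the
    tensor product of E and E_r. *)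
Definition pdot (s t : parity) : bool := (s.1 && t.1) (+) (s.2 && t.2).

Lemma pdotC s t : pdot s t = pdot t s.
Proof. by rewrite /pdot andbC [_.2 && _]andbC. Qed.

Lemma pdotDl s t u : pdot (padd s t) u = pdot s u (+) pdot t u.
Proof. by case: s t u => [[] []] [[] []] [[] []]. Qed.

Lemma pdotDr s t u : pdot u (padd s t) = pdot u s (+) pdot u t.
Proof. by rewrite !(pdotC u) pdotDl. Qed.

(** Each step of a left-normed commutator contributes 1 - (-1)^[pdot], where [s] is the total parity
    of the entries absorbed so far; [chain] says that no step contributes 0. *)
Fixpoint chain (s : parity) (ts : seq parity) : bool :=
  if ts is t :: ts' then pdot s t && chain (padd s t) ts' else true.

(** The running sum starts at (1,0) or (0,1). An entry (1,1) swaps its components; any other entry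
    that pairs with it equals it, and leaves the sum (0,0), with which no later entry pairs. *)
Lemma chain_rcons s ts t : s.1 (+) s.2 ->
  chain s (rcons ts t) =
    all (pred1 (true, true)) ts && pdot (if odd (size ts) then (s.2, s.1) else s) t.
Proof.
elim: ts s => [|u ts IH] s s12 /=; first by rewrite andbT.
have [-> |] := eqVneq u (true, true).
  rewrite IH; last by case: s s12 => [[] []].
  by case: s s12 => [[] []] //= _; case: (odd _).
case: s s12 => [[] []] //= _; case: u => [[] []] //= _;
  by case: ts {IH} => [|? ?].
Qed.

Lemma chain_all_neq0 s ts : chain s ts -> all (predC1 (false, false)) ts.
Proof.
elim: ts s => //= t ts IH s /andP[st /IH ->]; rewrite andbT.
by apply: contraTneq st => ->; rewrite /pdot !andbF.
Qed.

(* Every entry between the first two and the last has parity (1,1), and so has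
   one of the first two. *)
Lemma chain_count_be s t ts : chain s (t :: ts) -> (0 < size ts)%N ->
  (size ts <= count (fun u : parity => u.2) (s :: t :: ts))%N.
Proof.
case/lastP: ts => // ts u /= /andP[st]; rewrite size_rcons => ch _.
(* The only pairing [s], [t] excluded here are two equal entries (1,0) or (0,1): their sum (0,0)
   does not pair with the next entry. *)
have : (padd s t).1 (+) (padd s t).2.
  case: s t st ch => [[] []] [[] []] //= _; by case: ts.
move=> e; move: ch; rewrite chain_rcons // => /andP[/all_pred1P tsE _].
have -> : count (fun v : parity => v.2) (rcons ts u) = (size ts + u.2)%N.
  by rewrite -cats1 count_cat /= addn0 [in LHS]tsE count_nseq mul1n.
have : (0 < s.2 + t.2)%N by case: s t st e => [[] []] [[] []] //=.
by case: (s.2) (t.2) (u.2) => [] [] [] //= _; rewrite ?addn1 ?addn0 ?add0n ?addnA ?add1n // leqW.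
Qed.

(** * Values of commutators under a functional that swaps words up to sign *)

Section ColorCommutation.
Variables (K : fieldType) (A : lalgType K) (wd : seq nat -> A).
Variables (phi : {linear A -> K^o}) (wpar : seq nat -> parity).
Hypothesis wd_cat : forall u v, wd (u ++ v) = wd u * wd v.
Hypothesis wpar_cat : forall u v, wpar (u ++ v) = padd (wpar u) (wpar v).
Hypothesis phi_swap : forall f u v g, phi (f * (wd u * wd v) * g) =
  (-1) ^+ pdot (wpar u) (wpar v) *: phi (f * (wd v * wd u) * g).
Implicit Types (f g h : A) (u v w a b : seq nat).

(** Under [phi], in every context, [f] behaves as [c] times the word [w]; being contextual, the
    relation is stable under products. *)
Definition evals f (c : K) w :=
  forall g h, phi (g * f * h) = c *: phi (g * wd w * h).

Lemma evals_word w : evals (wd w) 1 w.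
Proof. by move=> g h; rewrite scale1r. Qed.

Lemma evalsM f c u g d v : evals f c u -> evals g d v -> evals (f * g) (c * d) (u ++ v).
Proof.
move=> fu gv x y; rewrite -scalerA wd_cat.
have -> : x * (f * g) * y = x * f * (g * y) by rewrite !mulrA.
have -> : x * (wd u * wd v) * y = x * wd u * wd v * y by rewrite !mulrA.
by rewrite fu -gv !mulrA.
Qed.

Lemma evalsD f c g d w : evals f c w -> evals g d w -> evals (f + g) (c + d) w.
Proof.
move=> fw gw x y; rewrite scalerDl -fw -gw.
by rewrite -linearD -mulrDl -mulrDr.
Qed.

Lemma evals_swap f c a u v b : evals f c (a ++ u ++ v ++ b) ->
  evals f (c * (-1) ^+ pdot (wpar u) (wpar v)) (a ++ v ++ u ++ b).
Proof.
move=> e x y; rewrite -scalerA e; congr (_ *: _).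
have := phi_swap (x * wd a) u v (wd b * y).
by rewrite !wd_cat !mulrA.
Qed.

(** Moving [v] back across [u] in the second product costs (-1)^[pdot], and 1 - (-1)^[pdot] is 0 or
    2. *)
Lemma evals_comm f c u v : evals f c u ->
  evals (comm f (wd v)) (c * ((pdot (wpar u) (wpar v))%:R * 2)) (u ++ v).
Proof.
move=> fu.
have e1 : evals (f * wd v) c (u ++ v).
  by rewrite -[c]mulr1; apply: evalsM => //; apply: evals_word.
have e2 : evals (wd v * f) (c * (-1) ^+ pdot (wpar v) (wpar u)) (u ++ v).
  have := @evals_swap (wd v * f) c [::] v u [::]; rewrite /= !cats0; apply.
  by rewrite -[c]mul1r; apply: evalsM => //; apply: evals_word.
move=> x y; rewrite /comm mulrBr mulrBl.
rewrite linearB /= e1 e2 -scalerBl pdotC; congr (_ *: _).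
case: (pdot _ _); first by rewrite expr1 mulrN mulr1 opprK mul1r mulr_natr.
by rewrite expr0 mulr1 mul0r mulr0 subrr.
Qed.

(** The value of a left-normed commutator whose entries have parities [s :: ts]: a factor 2 for each
    commutation, or 0 as soon as one of them vanishes. *)
Definition kappa (s : parity) ts : K := (chain s ts)%:R * 2 ^+ size ts.

Lemma kappa_neq0 s ts : kappa s ts != 0 -> chain s ts.
Proof. by apply: contraR => /negbTE ne; rewrite /kappa ne mul0r. Qed.

Lemma evals_lncomm w (ws : seq (seq nat)) :
  evals (lncomm (map wd (w :: ws))) (kappa (wpar w) (map wpar ws)) (flatten (w :: ws)).
Proof.
rewrite -[kappa _ _]mul1r /=.
elim: ws w (wd w) (1 : K) (evals_word w) => [|v ws IH] w f c fw /=.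
  by rewrite cats0 /kappa /= !mulr1.
have -> : c * kappa (wpar w) (wpar v :: map wpar ws) =
    c * ((pdot (wpar w) (wpar v))%:R * 2) * kappa (wpar (w ++ v)) (map wpar ws).
  rewrite wpar_cat /kappa /= exprS -!mulrA; congr (_ * _).
  by case: (pdot _ _); rewrite /= ?mul0r // !mul1r mulrCA.
by rewrite catA; apply: IH (evals_comm v fw).
Qed.

End ColorCommutation.

(** * The sign functional attached to a parity of the letters *)

Section SignFunctional.
Variables (K : fieldType) (n : nat) (tau : nat -> parity).
Local Notation A := (free_alg K).
Implicit Types (f g h : A) (u v w a b : seq nat).

Definition wpar w : parity := foldr (fun x => padd (tau x)) (false, false) w.

Lemma wpar_cat u v : wpar (u ++ v) = padd (wpar u) (wpar v).
Proof.
elim: u => [|x u IH] /=; first by case: (wpar v) => [[] []].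
by rewrite IH /padd /= !addbA.
Qed.

Lemma wpar1 x : wpar [:: x] = tau x.
Proof. by rewrite /= /padd /= !addbF; case: (tau x). Qed.

Lemma wpar_perm u v : perm_eq u v -> wpar u = wpar v.
Proof.
have cE w : wpar w = (odd (count (fun x => (tau x).1) w), odd (count (fun x => (tau x).2) w)).
  by elim: w => //= x w ->; rewrite /padd /= !oddD !oddb.
by move=> /permP p; rewrite !cE !p.
Qed.

(** The sign of sorting [w]: each inversion contributes the form of the parities of its two
    letters. *)
Fixpoint wsign w : bool :=
  if w is x :: w' then pdot (tau x) (wpar [seq y <- w' | (y < x)%N]) (+) wsign w'
  else false.

Lemma wsign_swap1 a x y b : x != y ->
  wsign (a ++ x :: y :: b) = pdot (tau x) (tau y) (+) wsign (a ++ y :: x :: b).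
Proof.
move=> xy; elim: a => [|z a IH] /=; last first.
  rewrite IH addbCA; congr (_ (+) (pdot _ _ (+) _)).
  apply: wpar_perm; apply: perm_filter; rewrite perm_cat2l.
  by rewrite -[x :: y :: b]/([:: x] ++ [:: y] ++ b) perm_catCA.
have [yx|xy'|e] := ltngtP y x; last by rewrite e eqxx in xy.
  rewrite /= pdotDr.
  by case: (pdot (tau x) (tau y)) (pdot (tau x) (wpar _)) (pdot (tau y) (wpar _)) (wsign b) => [] [] [] [].
rewrite /= pdotDr (pdotC (tau y) (tau x)).
by case: (pdot (tau x) (tau y)) (pdot (tau x) (wpar _)) (pdot (tau y) (wpar _)) (wsign b) => [] [] [] [].
Qed.

Lemma wsign_move a x v b : x \notin v ->
  wsign (a ++ x :: v ++ b) = pdot (tau x) (wpar v) (+) wsign (a ++ v ++ x :: b).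
Proof.
elim: v a => [|y v IH] a /=; first by rewrite /pdot !andbF.
rewrite inE negb_or => /andP[xy xv].
rewrite wsign_swap1 // -[a ++ y :: x :: _]cat_rcons IH // cat_rcons pdotDr addbA.
by [].
Qed.

Lemma wsign_swap a u v b : uniq (u ++ v) ->
  wsign (a ++ u ++ v ++ b) = pdot (wpar u) (wpar v) (+) wsign (a ++ v ++ u ++ b).
Proof.
elim: u a => [|x u IH] a //=; rewrite mem_cat negb_or -andbA => /and3P[_ xv uv].
rewrite -cat_rcons IH // cat_rcons wsign_move // pdotDl addbA.
by rewrite [pdot (tau x) _ (+) _]addbC.
Qed.

(** The coefficient of the product of all generators when each letter is sent to a generator of its
    parity, and 0 on words that are not multilinear. *)
Definition wsgn w : K^o := if perm_eq w (iota 0 n) then (-1) ^+ wsign w else 0.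

(* Locked, lest unification unfold it into finite sums. *)
Fact sgnf_key : unit. Proof. exact: tt. Qed.
Definition sgnf : {linear A -> K^o} :=
  locked_with sgnf_key (lext wsgn : {linear A -> K^o}).

Lemma sgnf_word w : sgnf (word K w) = wsgn w.
Proof. by rewrite /sgnf locked_withE; exact: lext_word. Qed.

Lemma wsgn_swap a u v b :
  wsgn (a ++ u ++ v ++ b) = (-1) ^+ pdot (wpar u) (wpar v) *: wsgn (a ++ v ++ u ++ b).
Proof.
rewrite /wsgn (_ : perm_eq (a ++ v ++ _) _ = perm_eq (a ++ u ++ v ++ b) (iota 0 n)); last first.
  by apply: permPl; rewrite perm_cat2l perm_catCA.
case: ifP => p; last by rewrite scaler0.
rewrite wsign_swap ?signr_addb //.
have : uniq (a ++ u ++ v ++ b) by rewrite (perm_uniq p) iota_uniq.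
by rewrite cat_uniq => /and3P[_ _]; rewrite catA cat_uniq => /and3P[].
Qed.

Lemma sgnf_swap f u v g :
  sgnf (f * (word K u * word K v) * g) =
    (-1) ^+ pdot (wpar u) (wpar v) *: sgnf (f * (word K v * word K u) * g).
Proof.
set e : K := (-1) ^+ _.
move: f; apply: (linear_word_eq (phi := sgnf \o lmulr g \o lmulr (word K u * word K v))
  (psi := e \*: (sgnf \o lmulr g \o lmulr (word K v * word K u)))) => a.
move: g; apply: (linear_word_eq (phi := sgnf \o lmull (word K a * (word K u * word K v)))
  (psi := e \*: (sgnf \o lmull (word K a * (word K v * word K u))))) => b /=.
by rewrite /lmull -!word_cat !sgnf_word -!catA wsgn_swap.
Qed.

(** A nonzero value on a commutator of [q.+2] words requires, by [chain_count_be], at least [q]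
    entries that are odd for the second factor, hence at least [q] such letters. *)
Lemma sgnf_kill q f :
  (0 < q)%N -> (count (fun x => (tau x).2) (iota 0 n) < q)%N -> comm_ideal q.+2 f -> sgnf f = 0.
Proof.
move=> q0 cq; move: f; apply: comm_ideal_kill => u ws v.
case: ws => [|w [|w' ws]] // [sz].
rewrite (evals_lncomm (@word_cat K) wpar_cat sgnf_swap) -!word_cat sgnf_word /wsgn.
case: ifP => p; last by rewrite scaler0.
suff /negbTE ch : ~~ chain (wpar w) (map wpar (w' :: ws)) by rewrite /kappa ch mul0r scale0r.
apply/negP => /chain_count_be; rewrite size_map sz => /(_ q0).
rewrite leqNgt => /negP; apply; apply: leq_ltn_trans cq.
(* An entry of odd second parity contains at least one letter of odd second parity. *)
have cnt s : (count (fun t : parity => t.2) (map wpar s)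
    <= count (fun x => (tau x).2) (flatten s))%N.
  elim: s => //= x s IH; rewrite count_cat leq_add //.
  case e: ((wpar x).2) => //; rewrite lt0n; apply: contraTneq e.
  by elim: x {IH} => //= y x IHx; rewrite /padd /=; case: ((tau y).2).
apply: leq_trans (cnt (w :: w' :: ws)) _.
by rewrite -(permP p) (count_cat _ (u ++ _)) (count_cat _ u) addnAC leq_addl.
Qed.

End SignFunctional.

(** * Test polynomials *)

Lemma seq_ind2step (T : Type) (P : seq T -> Prop) :
  P [::] -> (forall x, P [:: x]) -> (forall x y s, P s -> P [:: x, y & s]) ->
  forall s, P s.
Proof.
move=> P0 P1 P2 s; suff [] : P s /\ forall x, P (x :: s) by [].
by elim: s => [|y s [Ps Pxs]]; split=> // x; apply: P2.
Qed.

Section Blocks.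
Variables (A : nzRingType) (wd : seq nat -> A).
Implicit Types (us ts vs zs : seq nat).

Definition lcomm (s : seq nat) : A := lncomm (map (fun x => wd [:: x]) s).

Definition quad p q s t : A :=
  lcomm [:: p; q] * lcomm [:: s; t] + lcomm [:: p; s] * lcomm [:: q; t].

Fixpoint quads us ts : A :=
  match us, ts with
  | p :: q :: us', s :: t :: ts' => quad p q s t * quads us' ts'
  | _, _ => 1
  end.

Fixpoint pairs vs : A :=
  if vs is v :: v' :: vs' then lcomm [:: v; v'] * pairs vs' else 1.

Definition test_poly x zs b us ts vs : A :=
  lcomm (x :: rcons zs b) * (quads us ts * pairs vs).

End Blocks.

Fixpoint quads_word (us ts : seq nat) : seq nat :=
  match us, ts with
  | p :: q :: us', s :: t :: ts' => p :: q :: s :: t :: quads_word us' ts'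
  | _, _ => [::]
  end.

Fixpoint pairs_word (vs : seq nat) : seq nat :=
  if vs is v :: v' :: vs' then v :: v' :: pairs_word vs' else [::].

Definition test_word x zs b us ts vs : seq nat :=
  (x :: rcons zs b) ++ quads_word us ts ++ pairs_word vs.

Lemma quads_word_perm us ts : size us = size ts -> ~~ odd (size us) ->
  perm_eq (quads_word us ts) (us ++ ts).
Proof.
elim/seq_ind2step: us ts => [|p|p q us IH] ts; rewrite //=.
  by case: ts.
case: ts => [|s [|t ts]] //= [sz]; rewrite negbK => od.
rewrite !perm_cons; apply: (@perm_trans _ (s :: t :: us ++ ts)).
  by rewrite !perm_cons; apply: IH.
by rewrite -[s :: t :: _]/([:: s; t] ++ us ++ ts) perm_catCA.
Qed.

Lemma pairs_word_even vs : ~~ odd (size vs) -> pairs_word vs = vs.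
Proof.
by elim/seq_ind2step: vs => //= x y s IH; rewrite negbK => /IH ->.
Qed.

Lemma mulf_neq0_inv (R : idomainType) (a b : R) : a * b != 0 -> a != 0 /\ b != 0.
Proof. by rewrite mulf_eq0 negb_or => /andP[]. Qed.

Section BlockValues.
Variables (K : fieldType) (tau : nat -> parity).
Hypothesis two_neq0 : 2 != 0 :> K.
Local Notation kap x s := (kappa K (tau x) (map tau s)).

(** Both terms are referred to the word [p q s t]; the second one produces [p s q t], whence the
    sign of swapping [s] and [q]. *)
Definition quad_val p q s t : K :=
  kap p [:: q] * kap s [:: t] + kap p [:: s] * kap q [:: t] * (-1) ^+ pdot (tau s) (tau q).

Fixpoint quads_val us ts : K :=
  match us, ts with
  | p :: q :: us', s :: t :: ts' => quad_val p q s t * quads_val us' ts'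
  | _, _ => 1
  end.

Fixpoint pairs_val vs : K :=
  if vs is v :: v' :: vs' then kap v [:: v'] * pairs_val vs' else 1.

Definition test_val x zs b us ts vs : K :=
  kap x (rcons zs b) * (quads_val us ts * pairs_val vs).

Local Notation live := (fun x => tau x != (false, false)).

Lemma kappa2_live p q : kap p [:: q] != 0 -> live p && live q.
Proof.
move/kappa_neq0 => /=; rewrite andbT => pq.
by apply/andP; split; apply: contraTneq pq => ->; rewrite /pdot ?andbF.
Qed.

Lemma quads_val_live us ts : quads_val us ts != 0 -> all live (quads_word us ts).
Proof.
elim/seq_ind2step: us ts => [|p|p q us IH] [|s [|t ts]] //=.
move=> /mulf_neq0_inv[q0 /IH ->]; rewrite andbT.
(* One of the two terms of the sum is nonzero, and either of them involves all four letters. *)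
have [/andP[k1 k2]|] := boolP ((kap p [:: q] != 0) && (kap s [:: t] != 0)).
  by have /andP[-> ->] := kappa2_live k1; have /andP[-> ->] := kappa2_live k2.
rewrite negb_and !negbK => e.
have /andP[k1 k2] : (kap p [:: s] != 0) && (kap q [:: t] != 0).
  have {}q0 : kap p [:: s] * kap q [:: t] * (-1) ^+ pdot (tau s) (tau q) != 0.
    by move: q0; rewrite /quad_val; case/orP: e => /eqP ->; rewrite ?mul0r ?mulr0 add0r.
  by case: (mulf_neq0_inv q0) => /mulf_neq0_inv[-> ->].
by have /andP[-> ->] := kappa2_live k1; have /andP[-> ->] := kappa2_live k2.
Qed.

Lemma pairs_val_live vs : pairs_val vs != 0 -> all live (pairs_word vs).
Proof.
elim/seq_ind2step: vs => //= x y s IH.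
by move=> /mulf_neq0_inv[/kappa2_live/andP[-> ->] /IH ->].
Qed.

Lemma test_val_live x zs b us ts vs :
  test_val x zs b us ts vs != 0 -> all live (test_word x zs b us ts vs).
Proof.
move=> /mulf_neq0_inv[/kappa_neq0 ch /mulf_neq0_inv[qn pn]].
rewrite /test_word !all_cat (quads_val_live qn) (pairs_val_live pn) !andbT /=.
have /= := chain_all_neq0 ch; rewrite all_map => -> /=; rewrite andbT.
case: zs ch => [|z zs] /= /andP[+ _]; by apply: contraTneq => ->.
Qed.

Lemma pairs_val_neq0 vs :
  all (fun x => tau x == (true, false)) vs -> pairs_val vs != 0.
Proof.
elim/seq_ind2step: vs => [_|x _|x y s IH] /=; rewrite ?oner_eq0 //.
move=> /and3P[/eqP -> /eqP -> /IH s0].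
by rewrite mulf_neq0 // /kappa /= expr1 mul1r.
Qed.

(* The E-identity [p,q][s,t] + [p,s][q,t] = 0 leaves only the second Grassmann
   factor: with s, t of parity (1,0) the value is nonzero iff p, q are both
   odd for that factor. *)
Lemma quads_val_neq0 us ts : size us = size ts -> ~~ odd (size us) ->
  all (fun x => tau x == (true, false)) ts ->
  (quads_val us ts != 0) = all (fun x => (tau x).2) us.
Proof.
elim/seq_ind2step: us ts => [|p|p q us IH] [|s [|t ts]] //=.
  by rewrite oner_eq0.
move=> [sz]; rewrite negbK => od /and3P[/eqP st /eqP tt ts1].
rewrite mulf_eq0 negb_or IH // andbA; congr (_ && _).
rewrite /quad_val /kappa /= st tt !expr1 !andbT.
have four : 2 * 2 != 0 :> K by rewrite mulf_neq0.
case: (tau p) (tau q) => [[] []] [[] []];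
  rewrite /pdot /= ?expr1 ?expr0 ?mulr0n ?mulr1n ?mul0r ?mulr0 ?mul1r ?mulr1 ?addr0 ?add0r
    ?mulrN1 ?oppr_eq0 ?subrr ?eqxx ?four //.
Qed.

End BlockValues.

Section BlockEvals.
Variables (K : fieldType) (A : lalgType K) (wd : seq nat -> A).
Variables (phi : {linear A -> K^o}) (wpar : seq nat -> parity) (tau : nat -> parity).
Hypothesis wd_cat : forall u v, wd (u ++ v) = wd u * wd v.
Hypothesis wd_nil : wd [::] = 1.
Hypothesis wpar_cat : forall u v, wpar (u ++ v) = padd (wpar u) (wpar v).
Hypothesis wpar1 : forall x, wpar [:: x] = tau x.
Hypothesis phi_swap : forall f u v g, phi (f * (wd u * wd v) * g) =
  (-1) ^+ pdot (wpar u) (wpar v) *: phi (f * (wd v * wd u) * g).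
Local Notation evals := (evals wd phi).

Lemma evals_lcomm x s : evals (lcomm wd (x :: s)) (kappa K (tau x) (map tau s)) (x :: s).
Proof.
have := evals_lncomm wd_cat wpar_cat phi_swap [:: x] [seq [:: y] | y <- s].
rewrite wpar1 -map_comp (eq_map (f := wpar \o _) (g := tau)) => [|y]; last exact: wpar1.
by rewrite -[_ :: map _ s]/(map (fun y => [:: y]) (x :: s)) -map_comp -[flatten _]/(flatten (map _ _)) flatten_seq1.
Qed.

Lemma evals1 : evals 1 1 [::].
Proof. by rewrite -wd_nil; apply: evals_word. Qed.

Lemma evals_quads us ts : evals (quads wd us ts) (quads_val K tau us ts) (quads_word us ts).
Proof.
elim/seq_ind2step: us ts => [|p|p q us IH] [|s [|t ts]] /=; try exact: evals1.
apply: (evalsM wd_cat (u := [:: p; q; s; t])); last exact: IH.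
apply: evalsD.
  exact: (evalsM wd_cat (u := [:: p; q]) (evals_lcomm _ _) (evals_lcomm _ _)).
have := evals_swap wd_cat phi_swap (f := lcomm wd [:: p; s] * lcomm wd [:: q; t])
  (a := [:: p]) (u := [:: s]) (v := [:: q]) (b := [:: t]).
rewrite !wpar1; apply.
exact: (evalsM wd_cat (u := [:: p; s]) (evals_lcomm _ _) (evals_lcomm _ _)).
Qed.

Lemma evals_pairs vs : evals (pairs wd vs) (pairs_val K tau vs) (pairs_word vs).
Proof.
elim/seq_ind2step: vs => [|x|x y s IH] /=; try exact: evals1.
by apply: (evalsM wd_cat (u := [:: x; y])) => //; apply: evals_lcomm.
Qed.

Lemma evals_test_poly x zs b us ts vs :
  evals (test_poly wd x zs b us ts vs) (test_val K tau x zs b us ts vs)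
    (test_word x zs b us ts vs).
Proof.
apply: (evalsM wd_cat); first exact: evals_lcomm.
exact: (evalsM wd_cat (evals_quads _ _) (evals_pairs _)).
Qed.

End BlockEvals.

(** * Linear spans and their products *)

Section LinearSpan.
Variables (K : fieldType) (V : lmodType K).
Implicit Types S : V -> Prop.

Lemma lspan_subspace S : subspace (lspan S).
Proof.
split=> [|c f g [M [a [u [Su ->]]]] [N [b [v [Sv ->]]]]].
  by exists 0%N, (fun=> 0), (fun=> 0); split=> [[]|]; rewrite ?big_ord0.
pose glue (T : Type) (x : 'I_M -> T) (y : 'I_N -> T) (i : 'I_(M + N)) :=
  match split i with inl j => x j | inr j => y j end.
exists (M + N)%N, (glue _ (fun i => c * a i) b), (glue _ u v); split.
  by move=> i; rewrite /glue; case: split.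
rewrite big_split_ord scaler_sumr /glue.
congr (_ + _); apply: eq_bigr => i _.
  by rewrite -[lshift _ _]/(unsplit (inl i)) unsplitK scalerA.
by rewrite -[rshift _ _]/(unsplit (inr i)) unsplitK.
Qed.

Lemma lspan_incl S f : S f -> lspan S f.
Proof.
by move=> Sf; exists 1%N, (fun=> 1), (fun=> f); split=> //; rewrite big_ord1 scale1r.
Qed.

Lemma lspan_ind S (P : V -> Prop) : subspace P ->
  (forall f, S f -> P f) -> forall f, lspan S f -> P f.
Proof.
move=> sP SP f [N [c [g [Sg ->]]]]; apply: subspace_sum => // i _.
by apply: subspaceZ => //; apply: SP.
Qed.

End LinearSpan.

Lemma lspanM (K : fieldType) (A : lalgType K) (S T R : A -> Prop) f g :
  (forall c (x y : A), c *: (x * y) = x * (c *: y)) ->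
  (forall x y, S x -> T y -> R (x * y)) -> lspan S f -> lspan T g -> lspan R (f * g).
Proof.
move=> sAr STR Sf Tg; have sR := lspan_subspace R; move: f Sf; apply: lspan_ind.
  split=> [|c x y Rx Ry]; first by rewrite mul0r; exact: sR.1.
  by rewrite mulrDl -scalerAl; exact: sR.2.
move=> x Sx; move: g Tg; apply: lspan_ind.
  split=> [|c y z Ry Rz]; first by rewrite mulr0; exact: sR.1.
  by rewrite mulrDr -sAr; exact: sR.2.
by move=> y Ty; apply: lspan_incl; apply: STR.
Qed.

(** * Test polynomials are proper, with known letters *)

Section BlockProper.
Variable K : fieldType.
Local Notation wd := (word K).

Lemma lcomm_var s : lcomm wd s = lncomm (map (var K) s).
Proof. by rewrite /lcomm; congr lncomm; apply: eq_map => x; rewrite word1. Qed.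

Lemma proper_subspace : subspace (@Defs.proper K).
Proof. exact: lspan_subspace. Qed.

Lemma properM f g : @Defs.proper K f -> Defs.proper g -> Defs.proper (f * g).
Proof.
apply: lspanM => [c x y|x y [ss [ss2 ->]] [ss' [ss2' ->]]]; first exact: malg_scalerAr.
by exists (ss ++ ss'); rewrite all_cat ss2 ss2' big_cat.
Qed.

Lemma proper1 : Defs.proper (1 : free_alg K).
Proof. by apply: lspan_incl; exists [::]; rewrite big_nil. Qed.

Lemma proper_lcomm s : (2 <= size s)%N -> Defs.proper (lcomm wd s).
Proof.
move=> s2; apply: lspan_incl; exists [:: s].
by rewrite /= s2 big_seq1 lcomm_var.
Qed.

Lemma supp_in_lcomm s : supp_in (perm_eq s) (lcomm wd s).
Proof.
have := @supp_in_perm_lncomm K [seq [:: y] | y <- s].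
by rewrite flatten_seq1 -map_comp.
Qed.

Lemma supp_in_perm1 : supp_in (perm_eq [::]) (1 : free_alg K).
Proof. by rewrite -word_nil; apply: supp_in_word. Qed.

Lemma proper_quads us ts : Defs.proper (quads wd us ts).
Proof.
elim/seq_ind2step: us ts => [|p|p q us IH] [|s [|t ts]] /=; try exact: proper1.
by apply: properM (IH _); apply: subspaceD proper_subspace _ _;
  apply: properM; apply: proper_lcomm.
Qed.

Lemma proper_pairs vs : Defs.proper (pairs wd vs).
Proof.
elim/seq_ind2step: vs => [|x|x y s IH] /=; try exact: proper1.
by apply: properM IH; apply: proper_lcomm.
Qed.

Lemma proper_test_poly x zs b us ts vs : Defs.proper (test_poly wd x zs b us ts vs).
Proof.
apply: properM; first by apply: proper_lcomm; rewrite /= size_rcons.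
exact: properM (proper_quads _ _) (proper_pairs _).
Qed.

Lemma supp_in_quads us ts : supp_in (perm_eq (quads_word us ts)) (quads wd us ts).
Proof.
elim/seq_ind2step: us ts => [|p|p q us IH] [|s [|t ts]] /=; try exact: supp_in_perm1.
apply: (@supp_in_permM _ [:: p; q; s; t]) (IH _).
apply: (subspaceD (@supp_in_subspace K _)).
  by apply: (@supp_in_permM _ [:: p; q] [:: s; t]); apply: supp_in_lcomm.
apply: (@supp_in_perm _ [:: p; s; q; t]).
  by rewrite perm_cons (perm_catCA [:: s] [:: q] [:: t]).
by apply: (@supp_in_permM _ [:: p; s] [:: q; t]); apply: supp_in_lcomm.
Qed.

Lemma supp_in_pairs vs : supp_in (perm_eq (pairs_word vs)) (pairs wd vs).
Proof.
elim/seq_ind2step: vs => [|x|x y s IH] /=; try exact: supp_in_perm1.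
by apply: (@supp_in_permM _ [:: x; y]) IH; apply: supp_in_lcomm.
Qed.

Lemma supp_in_test_poly x zs b us ts vs :
  supp_in (perm_eq (test_word x zs b us ts vs)) (test_poly wd x zs b us ts vs).
Proof.
apply: supp_in_permM; first exact: supp_in_lcomm.
by apply: supp_in_permM; [exact: supp_in_quads | exact: supp_in_pairs].
Qed.

End BlockProper.

(** * A triangular family *)

Section Letters.
Variable n : nat.
Implicit Types X Y : {set 'I_n}.

Definition letters X : seq nat := map val (enum X).

Lemma letters_uniq X : uniq (letters X).
Proof. by rewrite (map_inj_uniq val_inj) enum_uniq. Qed.

Lemma mem_letters X (x : 'I_n) : (val x \in letters X) = (x \in X).
Proof. by rewrite (mem_map val_inj) mem_enum. Qed.

Lemma size_letters X : size (letters X) = #|X|.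
Proof. by rewrite size_map -cardE. Qed.

Lemma lettersP X y : reflect (exists2 x : 'I_n, x \in X & y = val x) (y \in letters X).
Proof.
apply: (iffP mapP) => -[x xX ->]; exists x => //; first by rewrite mem_enum in xX.
by rewrite mem_enum.
Qed.

Lemma letters_sub X (Y : {set 'I_n}) : {subset letters X <= letters Y} -> X \subset Y.
Proof. by move=> XY; apply/subsetP => x; rewrite -!mem_letters => /XY. Qed.

Lemma lettersID X Y : Y \subset X -> perm_eq (letters X) (letters Y ++ letters (X :\: Y)).
Proof.
move=> YX; apply: uniq_perm; first exact: letters_uniq.
  rewrite cat_uniq !letters_uniq andbT /=; apply/hasPn => y /lettersP[x xX ->].
  by rewrite mem_letters; move: xX; rewrite inE => /andP[].
move=> y; rewrite mem_cat; apply/lettersP/orP => [[x xX ->]|].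
  by rewrite !mem_letters inE xX andbT; case: (x \in Y); [left|right].
case=> /lettersP[x xX ->]; exists x => //; first exact: (subsetP YX).
by move: xX; rewrite inE => /andP[].
Qed.

Lemma letters_setT : letters setT = iota 0 n.
Proof. by rewrite /letters enum_setT -enumT val_enum_ord. Qed.

End Letters.

Section TriangularFamily.
Variables (K : fieldType) (n r : nat).
Hypothesis two_neq0 : 2 != 0 :> K.
Hypothesis r_even : ~~ odd r.
Local Notation index := ({set 'I_n} * {set 'I_n} * {set 'I_n})%type.
Implicit Types (i j : index) (T S Z : {set 'I_n}).

(* The first r + 2 letters of T are reserved as auxiliary letters of parity
   (1,0). *)
Definition ground T : {set 'I_n} := [set x : 'I_n | val x \in drop r.+2 (letters T)].

(** The index is the triple (T, S, Z). The last condition makes the number of letters left for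
    [pairs] even. *)
Definition admissible i : bool :=
  [&& (r.+2 <= #|i.1.1|)%N, i.1.2 \subset ground i.1.1, #|i.1.2| == r,
      i.2 \subset i.1.2 & odd #|i.2| == odd #|i.1.1|].

(** The parity is (1,0) on T minus S, (1,1) on Z, (0,1) on S minus Z, and (0,0) outside T when the
    index is admissible. *)
Definition index_parity i : nat -> parity :=
  fun x => (x \in letters (i.1.1 :\: (i.1.2 :\: i.2)), x \in letters i.1.2).

(** Lexicographic order on the sizes of T and Z, since the size of Z is below [n.+1]. *)
Definition height i : nat := (#|i.1.1| * n.+1 + #|i.2|)%N.

Lemma ground_sub T : ground T \subset T.
Proof. by apply/subsetP => x; rewrite inE -mem_letters => /mem_drop. Qed.

Lemma letters_ground T : perm_eq (letters (ground T)) (drop r.+2 (letters T)).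
Proof.
apply: uniq_perm; rewrite ?letters_uniq ?drop_uniq ?letters_uniq // => y.
apply/lettersP/idP => [[x + ->]|yd]; first by rewrite inE.
have /lettersP[x _ e] := mem_drop yd.
by exists x => //; rewrite inE -e.
Qed.

Lemma index_parity_live i x : admissible i ->
  index_parity i x != (false, false) -> x \in letters i.1.1.
Proof.
move=> /and5P[_ SG _ _ _]; rewrite /index_parity xpair_eqE negb_and !eqbF_neg !negbK.
case/orP => /lettersP[y yX ->]; rewrite mem_letters.
  by move: yX; rewrite inE => /andP[].
by apply: (subsetP (ground_sub _)); apply: (subsetP SG).
Qed.

Lemma index_parity_ref i x : admissible i -> x \in take r.+2 (letters i.1.1) ->
  index_parity i x = (true, false).
Proof.
move=> /and5P[_ SG _ _ _] xt; have /lettersP[y yT e] := mem_take xt.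
have yS : y \notin i.1.2.
  apply/negP => /(subsetP SG); rewrite inE => yd.
  have := letters_uniq i.1.1; rewrite -{1}(cat_take_drop r.+2 (letters i.1.1)) cat_uniq.
  by case/and3P => _ /hasPn/(_ _ yd); rewrite /= -e xt.
by rewrite /index_parity e !mem_letters !inE (negbTE yS) andbF yT.
Qed.

Lemma index_parity_out i x : x \in letters (ground i.1.1 :\: i.1.2) ->
  index_parity i x = (true, false).
Proof.
move=> /lettersP[y]; rewrite inE => /andP[yS yG ->].
by rewrite /index_parity !mem_letters !inE (negbTE yS) andbF -mem_letters; rewrite inE in yG; rewrite (mem_drop yG).
Qed.

Lemma index_parity_both i x : admissible i -> x \in letters i.2 ->
  index_parity i x = (true, true).
Proof.
move=> /and5P[_ SG _ ZS _] /lettersP[y yZ ->].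
have yS := subsetP ZS _ yZ; have yT := subsetP (ground_sub _) _ (subsetP SG _ yS).
by rewrite /index_parity !mem_letters !inE yS yZ yT.
Qed.

Lemma index_parity_snd i x : x \in letters (i.1.2 :\: i.2) ->
  index_parity i x = (false, true).
Proof.
move=> /lettersP[y]; rewrite inE => /andP[yZ yS ->].
by rewrite /index_parity !mem_letters !inE yS yZ.
Qed.

(* The second components of the parities select S and the letters of parity
   (1,1) form Z, so the test polynomial of i detects S and bounds Z. *)
Lemma index_lists i : admissible i -> exists x zs b us ts vs,
  [/\ perm_eq (test_word x zs b us ts vs) (letters i.1.1),
      size us = size ts /\ ~~ odd (size us),
      all (mem (take r.+2 (letters i.1.1))) (x :: ts) /\ zs = letters i.2,
      if odd #|i.2| then letters (i.1.2 :\: i.2) = b :: us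
      else letters (i.1.2 :\: i.2) = us /\ b \in take r.+2 (letters i.1.1)
    & ~~ odd (size vs) /\
      all (mem (take r.+2 (letters i.1.1) ++ letters (ground i.1.1 :\: i.1.2))) vs].
Proof.
move=> /and5P[rT SG /eqP Sr ZS /eqP oZ].
have szS : (#|i.2| + #|i.1.2 :\: i.2| = r)%N.
  by rewrite -Sr -(cardsID i.2 i.1.2) (setIidPr ZS).
have pT : perm_eq (letters i.1.1) (take r.+2 (letters i.1.1) ++ (letters i.2 ++
    letters (i.1.2 :\: i.2) ++ letters (ground i.1.1 :\: i.1.2))).
  rewrite -{1}(cat_take_drop r.+2 (letters i.1.1)) perm_cat2l.
  rewrite perm_sym catA (perm_trans _ (letters_ground i.1.1)) // perm_sym.
  rewrite (perm_trans (lettersID SG)) // perm_cat2r; exact: lettersID.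
have szt : size (take r.+2 (letters i.1.1)) = r.+2.
  by rewrite size_takel // size_letters.
(* Of the [r.+2] reserved letters, [x] opens the long commutator, [b0] may close it, and the [r]
   letters of [ts0] are enough to accompany [us]. *)
case et : (take r.+2 (letters i.1.1)) szt pT => [|x [|b0 ts0]] // [szt] pT.
(* The head of [l] closes the long commutator and its tail is [us]. The choice makes [us] even; for
   odd Z the set S minus Z is nonempty because [r] is even. *)
pose l := if odd #|i.2| then letters (i.1.2 :\: i.2) else b0 :: letters (i.1.2 :\: i.2).
have lE : l = head 0%N l :: behead l.
  rewrite /l; case: ifP => // o; case e: (letters _) => //.
  move: szS; rewrite -(size_letters (_ :\: _)) e /= addn0 => Zr.
  by move: r_even; rewrite -Zr o.
pose us := behead l.
have us_even : ~~ odd (size us).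
  by rewrite size_behead /l; case: ifP => o /=; rewrite size_letters; clear -szS o r_even; lia.
have us_le : (size us <= size ts0)%N.
  by rewrite size_behead /l szt; case: ifP => o /=; rewrite size_letters; clear -szS; lia.
pose vs := (if odd #|i.2| then [:: b0] else [::]) ++ drop (size us) ts0 ++
  letters (ground i.1.1 :\: i.1.2).
have szts : size us = size (take (size us) ts0) by rewrite size_takel.
have pW : perm_eq ((x :: rcons (letters i.2) (head 0%N l)) ++
    (us ++ take (size us) ts0) ++ vs) (letters i.1.1).
  rewrite perm_sym (perm_trans pT) //; apply/permP => p.
  have cl : count p l = (p (head 0%N l) + count p us)%N by rewrite lE.
  have ct : count p ts0 = (count p (take (size us) ts0) + count p (drop (size us) ts0))%N.
    by rewrite -count_cat cat_take_drop.
  rewrite /= -cats1 !count_cat /= ct.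
  move: cl; rewrite /l; case: ifP => o /= cl; rewrite ?count_cat /=; clear -cl; lia.
have vs_even : ~~ odd (size vs).
  have := perm_size pW; rewrite !size_cat /= size_rcons !size_letters -szts.
  move: oZ us_even szS; move: (size us) (size vs) => a c; clear -r_even; lia.
exists x, (letters i.2), (head 0%N l), us, (take (size us) ts0), vs; split.
- rewrite /test_word (pairs_word_even vs_even); apply: perm_trans pW.
  by rewrite perm_cat2l perm_cat2r quads_word_perm.
- by [].
- split=> //=; rewrite inE eqxx /=; apply/allP => y /mem_take yt.
  by rewrite !inE yt !orbT.
- rewrite /us /l; case: ifP => o; first by move: lE; rewrite /l o.
  by rewrite o /= !inE eqxx orbT.
split=> //; rewrite /vs !all_cat; apply/and3P; split.
- by case: ifP => //= _; rewrite !inE eqxx orbT.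
- by apply/allP => y /mem_drop yt; rewrite /= !inE mem_cat yt !orbT.
- by apply/allP => y yt; rewrite /= !inE mem_cat yt !orbT.
Qed.

Lemma count_index_parity i : admissible i ->
  count (fun x => (index_parity i x).2) (iota 0 n) = r.
Proof.
move=> /and5P[_ _ /eqP Sr _ _].
rewrite -letters_setT count_map -Sr (eq_count (a2 := mem i.1.2)) => [|x].
  by rewrite enum_setT -size_filter cardE [in RHS]/(enum _).
exact: mem_letters.
Qed.

Lemma sgnf_index_kill i f : admissible i -> comm_ideal r.+3 f ->
  sgnf K n (index_parity i) f = 0.
Proof. by move=> ai; apply: sgnf_kill => //; rewrite count_index_parity. Qed.

(** The witness is the word of the letters outside T times the test polynomial on T. If the
    functional of [j] is nonzero on it, T can only grow; if T is the same, Z can only grow and S is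
    the same, so [height] increases unless [j = i]. *)
Lemma test_family i : admissible i -> exists f : free_alg K,
  [/\ multilinear n f, i.1.1 = setT -> Defs.proper f,
      sgnf K n (index_parity i) f != 0
    & forall j, admissible j -> sgnf K n (index_parity j) f != 0 ->
        j != i -> (height i < height j)%N].
Proof.
move=> ai; have [x [zs [b [us [ts [vs [pW [szu ou] [rf zsE] bE [ov vsE]]]]]]]] := index_lists ai.
pose g := test_poly (word K) x zs b us ts vs.
have pC : perm_eq (letters (~: i.1.1) ++ test_word x zs b us ts vs) (iota 0 n).
  rewrite -letters_setT; apply: (perm_trans (y := letters (~: i.1.1) ++ letters i.1.1)).
    by rewrite perm_cat2l.
  by rewrite perm_catC perm_sym -setTD; apply: lettersID; apply: subsetT.
have ev j : sgnf K n (index_parity j) (word K (letters (~: i.1.1)) * g) =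
    test_val K (index_parity j) x zs b us ts vs *:
      wsgn K n (index_parity j) (letters (~: i.1.1) ++ test_word x zs b us ts vs).
  have := evals_test_poly (@word_cat K) (word_nil K) (@wpar_cat (index_parity j))
    (@wpar1 (index_parity j)) (@sgnf_swap K n (index_parity j)) x zs b us ts vs
    (word K (letters (~: i.1.1))) 1.
  by rewrite !mulr1 -word_cat sgnf_word.
exists (word K (letters (~: i.1.1)) * g); split.
- apply/multilinearP; apply: (supp_in_perm pC).
  by apply: supp_in_permM; [apply: supp_in_word | apply: supp_in_test_poly].
- move=> ->; rewrite setCT /letters enum_set0 word_nil mul1r.
  exact: proper_test_poly.
- rewrite ev /wsgn pC scaler_eq0 negb_or signr_eq0 andbT.
  move: (rf) => /=/andP[xr tsr].
  have xE := index_parity_ref ai xr.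
  have tsE : all (fun y => index_parity i y == (true, false)) ts.
    by apply/allP => y /(allP tsr) yr; rewrite (index_parity_ref ai yr).
  apply: mulf_neq0; last apply: mulf_neq0.
  + rewrite /kappa mulf_neq0 ?expf_neq0 // map_rcons xE chain_rcons // size_map.
    rewrite all_map (_ : all _ zs) /=; last first.
      by apply/allP => y; rewrite zsE /= => /(index_parity_both ai) ->.
    rewrite zsE size_letters; case: ifP bE => o; last first.
      by case=> _ /(index_parity_ref ai) ->; rewrite oner_eq0.
    move=> e; have /index_parity_snd -> : b \in letters (i.1.2 :\: i.2).
      by rewrite e mem_head.
    by rewrite oner_eq0.
  + rewrite quads_val_neq0 //; apply/allP => y yus.
    have /index_parity_snd -> // : y \in letters (i.1.2 :\: i.2).
    by case: ifP bE => _; [move=> -> | case=> -> _]; rewrite ?inE yus ?orbT.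
  + apply: pairs_val_neq0 => //; apply/allP => y /(allP vsE) /=; rewrite mem_cat.
    by case/orP => [/(index_parity_ref ai) -> | /index_parity_out ->].
move=> j aj; rewrite ev scaler_eq0 negb_or => /andP[tv _] ji.
(* All letters of a test word are live for [j], and live letters belong to the T of [j]. *)
have sub : i.1.1 \subset j.1.1.
  apply: letters_sub => y; rewrite -(perm_mem pW) => yw.
  by apply: (index_parity_live aj); apply: (allP (test_val_live tv)).
have leZ (X : {set 'I_n}) : (#|X| < n.+1)%N by rewrite ltnS -[n in leqRHS]card_ord max_card.
rewrite /height; have [Te|/eqP Tne] := eqVneq i.1.1 j.1.1; last first.
  have : (#|i.1.1| < #|j.1.1|)%N by rewrite proper_card // properEneq sub; apply/andP; split=> //; apply/eqP.
  by move: (leZ i.2) (leZ j.2); clear; nia.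
move: rf zsE => /=[/andP[xr tsr] zsE]; rewrite Te in xr tsr.
have xE := index_parity_ref aj xr.
have tsE : all (fun y => index_parity j y == (true, false)) ts.
  by apply/allP => y /(allP tsr) yr; rewrite (index_parity_ref aj yr).
have [/kappa_neq0 ch /mulf_neq0_inv[qn _]] := mulf_neq0_inv tv.
move: qn; rewrite quads_val_neq0 // => /allP usS.
move: ch; rewrite map_rcons xE chain_rcons // size_map all_map => /andP[/allP zsj bj].
(* The inner entries [zs] of the long commutator are forced to have parity (1,1) for [j]. *)
have Zsub : i.2 \subset j.2.
  apply: letters_sub => y; rewrite -zsE => /zsj /= /eqP yE.
  move: (f_equal fst yE) (f_equal snd yE); rewrite /index_parity /=.
  case/lettersP => y' + ey; rewrite ey !mem_letters !inE => /andP[+ _] yS.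
  by rewrite yS andbT negbK.
(* A letter of S is in [zs], hence (1,1) for [j], or in [us], hence in the S of [j] by the quads, or
   it is [b] with [zs] of odd length, where the running sum (0,1) forces its second parity. *)
have Ssub : i.1.2 \subset j.1.2.
  apply: letters_sub => y yS; have [yZ|yZ] := boolP (y \in letters i.2).
    rewrite -zsE in yZ; have /eqP yE := zsj _ yZ.
    by move: (f_equal snd yE) => /=.
  have yU : y \in letters (i.1.2 :\: i.2).
    case/lettersP: yS yZ => y' yS ->; rewrite !mem_letters => yZ.
    by rewrite inE yZ.
  move: bE bj; rewrite zsE size_letters; case: ifP => _.
    move=> e; move: yU; rewrite e inE => /orP[/eqP ->|/usS] //.
  by case=> e _ _; move: yU; rewrite e => /usS.
have Se : i.1.2 = j.1.2.
  apply/eqP; rewrite eqEcard Ssub /=; move: ai aj => /and5P[_ _ /eqP -> _ _].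
  by move=> /and5P[_ _ /eqP -> _ _].
rewrite Te ltn_add2l proper_card // properEneq Zsub andbT.
apply: contra ji => /eqP Ze; apply/eqP.
by case: i j Te Se Ze {ai aj ev sub leZ xE tsE zsj bj usS tv tsr zsE xr vsE bE pC pW g Zsub Ssub} => [[? ?] ?] [[? ?] ?] /= -> -> ->.
Qed.

End TriangularFamily.

(** * Counting *)

Section LowerBound.
Variables (K : fieldType) (n r : nat).
Hypothesis two_neq0 : 2 != 0 :> K.
Hypothesis r_even : ~~ odd r.

(** The predicate [P] serves both bounds: all T for the codimension, and T equal to the whole set
    for the proper one, where the test polynomials are proper. *)
Lemma leq_dim_admissible (U : free_alg K -> Prop) (P : pred ({set 'I_n} * {set 'I_n} * {set 'I_n})) :
  (forall f, U f -> multilinear n f) ->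
  (forall i f, P i -> multilinear n f -> (i.1.1 = setT -> Defs.proper f) -> U f) ->
  (#|[pred i | admissible r i && P i]| <= dim_mod U (@lie_nilp_ids K r.+2 n))%N.
Proof.
move=> Um PU; pose I := {i | admissible (n := n) r i && P i}.
suff : (#|{: I}| <= dim_mod U (@lie_nilp_ids K r.+2 n))%N by rewrite card_sig.
have ex (i : I) := test_family two_neq0 r_even (andP (valP i)).1.
have [v vP] := choice ex.
apply: (triangular_leq_dim (v := v) (ht := fun i : I => height (val i))
  (phi := fun i : I => sgnf K n (index_parity (val i))) (@lie_nilp_ids_subspace K r.+2 n)).
- by move=> u /Um; apply: multilinear_in_span_mod.
- by move=> i; have [mv pv _ _] := vP i; apply: (PU (val i)) => //; case/andP: (valP i).
- by move=> i w [wI _]; apply: (sgnf_index_kill (r := r)) => //; case/andP: (valP i).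
- by move=> i; have [_ _ + _] := vP i.
move=> i j nz ij; have [_ _ _ H] := vP j; apply: H => //.
by case/andP: (valP i).
Qed.

Lemma leq_codim : (#|[pred i | admissible (n := n) r i]| <= codim K r.+2 n)%N.
Proof.
rewrite (eq_card (B := [pred i | admissible (n := n) r i && xpredT i])) => [|i].
  exact: leq_dim_admissible.
by rewrite !inE andbT.
Qed.

Lemma leq_proper_codim :
  (#|[pred i | admissible (n := n) r i && (i.1.1 == setT)]| <= proper_codim K r.+2 n)%N.
Proof.
apply: leq_dim_admissible => [f []|i f /eqP iT mf pf] //.
by split=> //; apply: pf.
Qed.

End LowerBound.

(** * Counting subsets by parity and by size *)

Section Counting.
Variable I : finType.

(** Toggling a fixed element of [S] exchanges the even and the odd subsets. *)
Lemma card_subset_parity (S : {set I}) b : S != set0 ->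
  #|[set Z : {set I} | (Z \subset S) && (odd #|Z| == b)]| = (2 ^ #|S|.-1)%N.
Proof.
case/set0Pn => x xS.
pose E b := [set Z : {set I} | (Z \subset S) && (odd #|Z| == b)].
pose f (Z : {set I}) := if x \in Z then Z :\ x else x |: Z.
have fK : involutive f.
  move=> Z; rewrite /f; case xZ: (x \in Z); first by rewrite setD11 setD1K.
  by rewrite setU11 setU1K // xZ.
have le c : (#|E c| <= #|E (~~ c)|)%N.
  rewrite -(card_imset (E c) (can_inj fK)); apply: subset_leq_card.
  apply/subsetP => y /imsetP[Z + ->]; rewrite inE => /andP[ZS /eqP <-].
  rewrite inE /f; case xZ: (x \in Z).
    rewrite (subset_trans (subsetDl _ _) ZS) /=.
    by rewrite (cardsD1 x Z) xZ /= negbK.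
  by rewrite subUset sub1set xS ZS cardsU1 xZ add1n /= eqxx.
have eqE : #|E b| = #|E (~~ b)|.
  by apply/eqP; rewrite eqn_leq le /=; have := le (~~ b); rewrite negbK.
have : (#|E b| + #|E (~~ b)| = 2 ^ #|S|)%N.
  rewrite -card_powerset -[in RHS](cardsID (E b) (powerset S)); congr (_ + _)%N.
    by apply: eq_card => Z; rewrite !inE; case: (Z \subset S).
  apply: eq_card => Z; rewrite !inE; case: (Z \subset S) => //=.
  by rewrite andbT; case: b {eqE} (odd _) => [] [].
rewrite -eqE addnn -[in RHS](prednK (n := #|S|)); last by apply/card_gt0P; exists x.
by rewrite expnS mul2n => /double_inj.
Qed.

Lemma sum_card_set (F : nat -> nat) :
  (\sum_(T : {set I}) F #|T| = \sum_(m < #|I|.+1) 'C(#|I|, m) * F m)%N.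
Proof.
rewrite (partition_big (fun T : {set I} => inord #|T| : 'I_#|I|.+1) xpredT) //=.
apply: eq_bigr => m _; rewrite -card_draws -[X in (X * _)%N]sum1_card big_distrl /=.
apply: eq_big => [T|T /eqP <-]; last by rewrite mul1n inordK // ltnS max_card.
by rewrite inE -(inj_eq val_inj) /= inordK // ltnS max_card.
Qed.

End Counting.

(** The number of pairs (S, Z) for a set T of size [m]. For [r = 0] only the empty pair is possible,
    and it needs [m] even. *)
Definition index_count (r m : nat) : nat :=
  if r == 0%N then ((2 <= m)%N && ~~ odd m : nat) else (2 ^ r.-1 * 'C(m - r.+2, r))%N.

Section CountAdmissible.
Variables n r : nat.

Lemma card_ground (T : {set 'I_n}) : #|ground r T| = (#|T| - r.+2)%N.
Proof. by rewrite -size_letters (perm_size (letters_ground _ _)) size_drop size_letters. Qed.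

Lemma card_admissible (P : pred {set 'I_n}) :
  #|[pred i | admissible (n := n) r i && P i.1.1]| = (\sum_(T | P T) index_count r #|T|)%N.
Proof.
rewrite -sum1_card (eq_bigl (fun i : _ * _ * _ => P i.1.1 && admissible r i)); last first.
  by move=> i; rewrite inE andbC.
rewrite -(pair_big_dep (fun TS : {set 'I_n} * {set 'I_n} => P TS.1)
  (fun TS Z => admissible r (TS, Z)) (fun _ _ => 1%N)) /=.
rewrite (eq_bigl (fun TS : _ * _ => P TS.1 && true)) => [|[T S]]; last by rewrite andbT.
rewrite -(pair_big_dep P (fun _ _ => true)
  (fun T S => \sum_(Z | admissible r (T, S, Z)) 1))%N /=.
apply: eq_bigr => T _.
rewrite (bigID (fun S : {set 'I_n} => (S \subset ground r T) && (#|S| == r))) /=.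
rewrite [X in (_ + X)%N]big1 ?addn0 => [|S SG]; last first.
  rewrite big1 // => Z; rewrite /admissible /=; case/and5P => _ sg sr _ _.
  by rewrite sg sr in SG.
have innerE (S : {set 'I_n}) : (S \subset ground r T) && (#|S| == r) ->
    (\sum_(Z | admissible r (T, S, Z)) 1 =
     (r.+2 <= #|T|) * #|[set Z : {set 'I_n} | (Z \subset S) && (odd #|Z| == odd #|T|)]|)%N.
  move=> /andP[sg sr]; rewrite /admissible /= sg sr /= sum1_card.
  have [rT|rT] := leqP r.+2 #|T|; last by rewrite mul0n; apply: eq_card0 => Z.
  by rewrite mul1n; apply: eq_card => Z; rewrite !inE.
rewrite (eq_bigr _ innerE) /index_count.
(* Parity splits the subsets of S into halves only when S is nonempty, so [r = 0] is separate. *)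
have [r0|r0] := posnP r.
  rewrite (big_pred1 set0) => [|S]; last first.
    rewrite r0 cards_eq0 /= andb_idl // => /eqP ->; exact: sub0set.
  rewrite r0; case: leqP => _; rewrite ?mul0n // mul1n.
  case oT : (odd #|T|).
    by apply: eq_card0 => Z; rewrite !inE subset0; case: eqP => // ->; rewrite cards0.
  rewrite (eq_card (B := [set set0])) ?cards1 // => Z.
  by rewrite !inE subset0; case: eqP => // ->; rewrite cards0.
rewrite (eq_bigr (fun=> (r.+2 <= #|T|) * 2 ^ r.-1))%N => [|S /andP[_ /eqP Sr]]; last first.
  by rewrite card_subset_parity ?Sr // -cards_eq0 Sr -lt0n.
rewrite sum_nat_const.
have -> : #|[pred S : {set 'I_n} | (S \subset ground r T) && (#|S| == r)]| = 'C(#|T| - r.+2, r).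
  by rewrite -card_ground -cards_draws; apply: eq_card => S; rewrite !inE.
have [rT|rT] := leqP r.+2 #|T|; first by rewrite mul1n mulnC.
(* Truncated subtraction gives 0 here, and C(0, r) = 0 because [r] is positive. *)
have /eqP -> : (#|T| - r.+2 == 0)%N by rewrite subn_eq0 ltnW.
by rewrite bin_small // muln0.
Qed.

Lemma card_admissible_all :
  #|[pred i | admissible (n := n) r i]| = (\sum_(m < n.+1) 'C(n, m) * index_count r m)%N.
Proof.
have := @sum_card_set 'I_n (index_count r); rewrite card_ord => <-.
by rewrite -(card_admissible xpredT); apply: eq_card => i; rewrite !inE andbT.
Qed.

Lemma card_admissible_setT :
  #|[pred i | admissible (n := n) r i && (i.1.1 == setT)]| = index_count r n.
Proof. by rewrite (card_admissible (pred1 setT)) big_pred1_eq cardsT card_ord. Qed.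

End CountAdmissible.

Lemma sum_bin_recr (n : nat) (F : nat -> nat) :
  (\sum_(m < n.+2) 'C(n.+1, m) * F m = \sum_(m < n.+1) 'C(n, m) * (F m + F m.+1))%N.
Proof.
under [RHS]eq_bigr do rewrite mulnDr; rewrite big_split /=.
rewrite big_ord_recl /= bin0 mul1n; under eq_bigr do rewrite /bump /= add1n binS mulnDl.
rewrite big_split /= addnA; congr (_ + _)%N.
by rewrite [in RHS]big_ord_recl big_ord_recr /= bin_small // mul0n addn0 bin0 mul1n.
Qed.

(** The sum is 2^(n-a) C(n, a), multiplied out to avoid a truncated exponent; induction on [n] by
    Pascal's rule. *)
Lemma sum_bin_bin (n a : nat) :
  ((\sum_(m < n.+1) 'C(n, m) * 'C(m, a)) * 2 ^ a = 2 ^ n * 'C(n, a))%N.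
Proof.
elim: n a => [|n IH] a.
  by rewrite big_ord1 bin0n mul1n; case: a.
rewrite (sum_bin_recr _ (fun m => 'C(m, a))); case: a => [|a].
  rewrite (eq_bigr (fun m : 'I_n.+1 => ('C(n, m) * 'C(m, 0)).*2)) => [|m _].
    rewrite -(big_morph _ doubleD (erefl : 0%N.*2 = 0%N)).
    by have := IH 0%N; rewrite !bin0 !muln1 expnS mul2n => ->.
  by rewrite !bin0 mulnDr muln1 addnn.
under eq_bigr do rewrite binS addnA addnn mulnDr -doubleMr.
rewrite big_split /=.
have := IH a; have := IH a.+1.
rewrite -(big_morph _ doubleD (erefl : 0%N.*2 = 0%N)) binS !expnS.
move: (\sum_(m < _) _ * 'C(_, a.+1))%N (\sum_(m < _) _ * 'C(_, a))%N => x y.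
by move: (2 ^ a)%N (2 ^ n)%N => u v; clear; nia.
Qed.

(** By Pascal's rule each unit subtracted from [m] costs at most C(m, r-1), so the shift affects
    only lower-order terms. *)
Lemma leq_bin_sub (m c r : nat) : (0 < r)%N ->
  ('C(m, r) <= 'C(m - c, r) + c * 'C(m, r.-1))%N.
Proof.
case: r => // r _ /=; elim: c => [|c IH]; first by rewrite subn0 leq_addr.
apply: leq_trans IH _; rewrite mulSn addnA leq_add2r subnS.
have le : ('C(m - c, r) <= 'C(m, r))%N by apply: leq_bin2l; exact: leq_subr.
case: (m - c)%N le => [|d] le; first exact: leq_addr.
by rewrite binS /= leq_add2l (leq_trans _ le) // leq_bin2l.
Qed.

(** * Binomial coefficients as rational polynomials *)

Section BinomialPolynomial.

Definition binp (a : nat) : {poly rat} :=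
  (a`!%:R)^-1 *: \prod_(i < a) ('X - (i%:R)%:P).

Lemma fact_neq0 a : a`!%:R != 0 :> rat.
Proof. by rewrite pnatr_eq0 -lt0n fact_gt0. Qed.

Lemma size_binp a : size (binp a) = a.+1.
Proof.
rewrite size_scale ?invr_eq0 ?fact_neq0 //.
by rewrite size_prod_XsubC -[in RHS](card_ord a) cardE enumT.
Qed.

Lemma lead_coef_binp a : lead_coef (binp a) = (a`!%:R)^-1.
Proof. by rewrite lead_coefZ (monicP (monic_prod_XsubC _ _ _)) mulr1. Qed.

Lemma horner_binp a m : (binp a).[m%:R] = 'C(m, a)%:R.
Proof.
rewrite hornerZ horner_prod; apply: (mulfI (fact_neq0 a)).
rewrite mulrA divff ?fact_neq0 // mul1r -natrM mulnC bin_ffact.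
rewrite ffact_prod natr_prod; have [am|ma] := leqP a m.
  by apply: eq_bigr => i _; rewrite hornerXsubC natrB // ltnW // (leq_trans _ am).
(* For [m < a] both products contain the factor of index [m], which is 0. *)
rewrite (bigD1 (Ordinal ma)) //= hornerXsubC subrr mul0r.
by rewrite (bigD1 (Ordinal ma)) //= subnn mul0r.
Qed.

Lemma size_binpB a (c : rat) : (0 < a)%N -> size (binp a - c *: binp a.-1) = a.+1.
Proof.
move=> a0; rewrite size_polyDl ?size_binp // size_polyN.
by apply: leq_ltn_trans (size_scale_leq _ _) _; rewrite size_binp prednK.
Qed.

Lemma lead_coef_binpB a (c : rat) : (0 < a)%N ->
  lead_coef (binp a - c *: binp a.-1) = (a`!%:R)^-1.
Proof.
move=> a0; rewrite lead_coefDl ?lead_coef_binp // size_polyN size_binp.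
by apply: leq_ltn_trans (size_scale_leq _ _) _; rewrite size_binp prednK.
Qed.

End BinomialPolynomial.

Lemma leq_index_count r m : (0 < r)%N ->
  (2 ^ r.-1 * 'C(m, r) <= index_count r m + 2 ^ r.-1 * (r.+2 * 'C(m, r.-1)))%N.
Proof.
move=> r0; rewrite /index_count -[r == _]negbK -lt0n r0 /= -mulnDr leq_mul2l.
by rewrite leq_bin_sub ?orbT.
Qed.

(** Weights C(n, m) are put on [leq_index_count] and both sums of products of binomials are
    evaluated by [sum_bin_bin]; doubling avoids the exponent [n - 1]. *)
Lemma sum_index_count_ge n r : (0 < r)%N ->
  (2 ^ n * 'C(n, r) <=
   2 * (\sum_(m < n.+1) 'C(n, m) * index_count r m) + 2 ^ n * (2 * r.+2 * 'C(n, r.-1)))%N.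
Proof.
case: r => // r _ /=; rewrite -(sum_bin_bin n r.+1).
have := sum_bin_bin n r.
set x := (\sum_(m < n.+1) _ * 'C(m, r))%N; set y := (\sum_(m < n.+1) _ * 'C(m, r.+1))%N.
set z := (\sum_(m < n.+1) _ * index_count _ _)%N => xE.
have : (2 ^ r * y <= z + 2 ^ r * (r.+3 * x))%N.
  rewrite /x /y /z !big_distrr /= -big_split /=; apply: leq_sum => m _.
  rewrite !(mulnCA _ 'C(n, m)) -mulnDr leq_mul2l.
  by rewrite (leq_index_count (r := r.+1)) ?orbT.
have -> : (2 ^ n * (2 * r.+3 * 'C(n, r)) = 2 * (2 ^ r * (r.+3 * x)))%N.
  by rewrite -mulnA mulnCA (mulnCA (2 ^ n)%N) -xE [(x * _)%N]mulnC (mulnCA r.+3).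
rewrite -mulnDr expnS [(y * _)%N]mulnC -mulnA leq_mul2l /=.
by [].
Qed.

(** For [r = 0] the sum counts the nonempty subsets of even size; the successor accounts for the
    empty one. *)
Lemma sum_index_count0_ge n : (0 < n)%N ->
  (2 ^ n.-1 <= (\sum_(m < n.+1) 'C(n, m) * index_count 0 m).+1)%N.
Proof.
move=> n0; have := @sum_card_set 'I_n (index_count 0); rewrite card_ord => <-.
have T0 : [set: 'I_n] != set0 by apply/set0Pn; exists (Ordinal n0).
have := card_subset_parity false T0; rewrite cardsT card_ord => <-.
rewrite -sum1_card big_mkcond /=.
have e1 : (\sum_(T : {set 'I_n}) (T == set0) = 1)%N.
  by rewrite -big_mkcond /= (big_pred1 set0).
rewrite -[X in (_ <= X)%N]addn1 -[X in (_ <= _ + X)%N]e1 -big_split; apply: leq_sum => T _; rewrite inE subsetT eqbF_neg /index_count /=.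
rewrite -cards_eq0; case: #|T| => [|[|m]] //=.
by case: (odd m).
Qed.

(** * Polynomial lower bounds *)

Section Bounds.
Variable K : fieldType.
Hypothesis two_neq0 : 2 != 0 :> K.

(** For [r = 0] and odd [n] there is no admissible index with T the whole set, whence the parity
    condition. *)
Lemma proper_codim_lower_bound r : ~~ odd r -> exists p : {poly rat},
  [/\ size p = r.+1, lead_coef p = 2 ^ (r%:Z - 1) / (r`!)%:R
    & forall n, (r.+2 <= n)%N -> (0 < r)%N || ~~ odd n ->
        p.[n%:R] <= (proper_codim K r.+2 n)%:R].
Proof.
move=> r_even; have [-> | r0] := posnP r.
  (* The prescribed leading coefficient is 1/2, while for even [n] the one admissible index gives
     the bound 1. *)
  exists (2^-1)%:P; split=> [||n n2 /= nev].
  - by rewrite size_polyC.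
  - by rewrite lead_coefC fact0 divr1.
  rewrite hornerC (@le_trans _ _ 1) // ler1n.
  have := leq_proper_codim n two_neq0 (isT : ~~ odd 0).
  by rewrite card_admissible_setT /index_count /= n2 nev.
exists (2 ^+ r.-1 *: (binp r - (r.+2)%:R *: binp r.-1)); split.
- by rewrite size_scale ?expf_neq0 // size_binpB.
- rewrite lead_coefZ lead_coef_binpB //; congr (_ / _).
  by have -> : r%:Z - 1 = r.-1%:Z by lia.
move=> n _ _; rewrite hornerZ hornerD hornerN horner_binp hornerZ horner_binp.
have := leq_proper_codim n two_neq0 r_even.
rewrite card_admissible_setT => le.
have := leq_trans (leq_index_count n r0) (leq_add le (leqnn _)).
rewrite -(ler_nat rat) natrD !natrM natrX.
move: (2 ^+ _ : rat) ('C(n, r)%:R : rat) ('C(n, r.-1)%:R : rat) (r.+2%:R : rat)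
  ((proper_codim K r.+2 n)%:R : rat) => s x y c d h.
rewrite mulrBr mulrA; lra.
Qed.

Lemma codim_lower_bound r : ~~ odd r -> exists xi eta : {poly rat},
  [/\ size xi = r.+1, lead_coef xi = (r`!%:R)^-1, (size eta <= r.+2)%N
    & forall n : nat, 2 ^ (n%:Z - 1) * xi.[n%:R] + eta.[n%:R] <= (codim K r.+2 n)%:R].
Proof.
move=> r_even; have le n := leq_codim n two_neq0 r_even.
have exp2 n : 2 ^ (n%:Z - 1) = 2 ^+ n / 2 :> rat by rewrite expfzDr.
have [r0 | r0] := posnP r.
  (* The constant -1 pays for the empty set T. *)
  exists 1, (-1)%:P; rewrite size_poly1 lead_coef1 r0 fact0 invr1 size_polyC; split=> // n.
  rewrite !hornerC mulr1; have [-> /=|n0] := posnP n.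
    by rewrite exp2 expr0; apply: le_trans (ler0n _ _); lra.
  have := leq_trans (sum_index_count0_ge n0) _; move: (le n).
  rewrite r0 card_admissible_all -ltnS => h /(_ _ h).
  rewrite -(ler_nat rat) natrX -[(codim _ _ _).+1]addn1 natrD exp2.
  have -> : 2 ^+ n = 2 * 2 ^+ n.-1 :> rat by rewrite -exprS prednK.
  by move: (2 ^+ n.-1) => s; lra.
(* Half of the inequality [sum_index_count_ge], read as a polynomial times 2^(n-1). *)
exists (binp r - (2 * r.+2)%:R *: binp r.-1), 0.
rewrite size_binpB // lead_coef_binpB // size_poly0; split=> // n.
rewrite horner0 addr0 hornerD hornerN horner_binp hornerZ horner_binp exp2.
have := sum_index_count_ge n r0; have := le n; rewrite card_admissible_all.
rewrite -!(ler_nat rat) natrD !natrM natrX.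
move: (_%:R : rat) (2 ^+ _ : rat) ('C(n, r)%:R : rat) ('C(n, r.-1)%:R : rat) (r.+2%:R : rat)
  ((codim K r.+2 n)%:R : rat) => X s x y c d h1 h2.
have -> : s / 2 * (x - 2 * c * y) = (s * x - s * (2 * c * y)) / 2 by field.
lra.
Qed.

End Bounds.

(** * Differential operators *)

Section DifferentialOperators.
Variable R : comNzRingType.
Implicit Types (D E : {poly R} -> {poly R}) (p q : {poly R}).

(* [diffop m D]: D is a differential operator of order less than m. *)
Fixpoint diffop m D : Prop :=
  if m is m'.+1 then forall q, diffop m' (fun p => D (q * p) - q * D p)
  else forall p, D p = 0.

Definition submorph D := forall p q, D (p - q) = D p - D q.

Lemma diffop_ext m D E : D =1 E -> diffop m D -> diffop m E.
Proof.
elim: m D E => [|m IH] D E DE /= Dm => [p|q]; first by rewrite -DE.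
by apply: IH (Dm q) => p; rewrite !DE.
Qed.

Lemma diffop0 m D : (forall p, D p = 0) -> diffop m D.
Proof.
elim: m D => [|m IH] D D0 //= q; apply: IH => p.
by rewrite !D0 mulr0 subr0.
Qed.

Lemma diffopD m D E : diffop m D -> diffop m E -> diffop m (fun p => D p + E p).
Proof.
elim: m D E => [|m IH] D E /= Dm Em => [p|q]; first by rewrite Dm Em addr0.
by apply: diffop_ext (IH _ _ (Dm q) (Em q)) => p; ring.
Qed.

Lemma diffop_mull m r D : diffop m D -> diffop m (fun p => r * D p).
Proof.
elim: m D => [|m IH] D /= Dm => [p|q]; first by rewrite Dm mulr0.
by apply: diffop_ext (IH _ (Dm q)) => p; ring.
Qed.

(** With d the derivation, the bracket of d D with [q] is d applied to the bracket of [D] with [q],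
    plus q' D. *)
Lemma diffop_deriv m D : diffop m D -> diffop m.+1 (fun p => (D p)^`()).
Proof.
elim: m D => [|m IH] D Dm.
  by apply: diffop0 => p; rewrite Dm deriv0.
move=> q; apply: (diffop_ext (D := fun p => (D (q * p) - q * D p)^`() + q^`() * D p)).
  by move=> p; rewrite derivB derivM; ring.
by apply: diffopD (IH _ (Dm q)) _; apply: diffop_mull.
Qed.

Lemma submorph0 D : submorph D -> D 0 = 0.
Proof. by move=> sD; have := sD 0 0; rewrite !subrr. Qed.

Lemma submorph_bracket D q : submorph D -> submorph (fun p => D (q * p) - q * D p).
Proof. by move=> sD x y; rewrite mulrBr !sD; ring. Qed.

(** Operators of orders at most [a] and [b] have a commutator of order below [a + b]; induction on
    [a + b] through the Jacobi identity. *)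
Lemma diffop_comm a b D E : submorph D -> submorph E ->
  diffop a.+1 D -> diffop b.+1 E -> diffop (a + b) (fun p => D (E p) - E (D p)).
Proof.
move: {-1}(a + b)%N (erefl (a + b)%N) => s; elim: s a b D E => [|s IH] a b D E abs sD sE Da Eb.
  move/eqP: abs; rewrite addn_eq0 => /andP[/eqP a0 /eqP b0] p.
  rewrite a0 /= in Da; rewrite b0 /= in Eb.
  (* An operator of order 0 is multiplication by its value at 1, and multiplications commute. *)
  have mul F (F1 : forall q p, F (q * p) - q * F p = 0) x : F x = x * F 1.
    by have /eqP := F1 x 1; rewrite subr_eq0 mulr1 => /eqP.
  by rewrite (mul E Eb (D p)) (mul D Da p) (mul D Da (E p)) (mul E Eb p); ring.
(* Jacobi: [[D, E], q] = [[D, q], E] + [D, [E, q]]. *)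
move=> q; apply: (diffop_ext (D := fun p =>
  ((D (q * E p) - q * D (E p)) - E (D (q * p) - q * D p)) +
  (D (E (q * p) - q * E p) - (E (q * D p) - q * E (D p))))).
  by move=> p; rewrite sE sD; ring.
(* If [a] or [b] is 0 the corresponding inner bracket is zero and the induction hypothesis does not
   apply. *)
have zl F G : submorph G -> (forall p, F p = 0) ->
    diffop s (fun p => F (G p) - G (F p)).
  by move=> sG F0; apply: diffop0 => p; rewrite !F0 (submorph0 sG) subr0.
have zr F G : submorph G -> (forall p, F p = 0) ->
    diffop s (fun p => G (F p) - F (G p)).
  by move=> sG F0; apply: diffop0 => p; rewrite !F0 (submorph0 sG) subr0.
apply: diffopD.
  apply: (diffop_ext (D := fun p => (fun p => D (q * p) - q * D p) (E p) -
    E ((fun p => D (q * p) - q * D p) p))) => //.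
  case: a Da abs => [|a] Da abs; first exact: (zl _ _ sE (Da q)).
  have {}abs : (a + b)%N = s by case: abs.
  exact: (IH a b _ E abs (submorph_bracket q sD) sE (Da q) Eb).
apply: (diffop_ext (D := fun p => D ((fun p => E (q * p) - q * E p) p) -
    (fun p => E (q * p) - q * E p) (D p))) => //.
case: b Eb abs => [|b] Eb abs; first exact: (zr _ _ sD (Eb q)).
have {}abs : (a + b)%N = s by move: abs; rewrite addnS => -[].
exact: (IH a b D _ abs sD (submorph_bracket q sE) Da (Eb q)).
Qed.

End DifferentialOperators.

(* The letters below l act on polynomials as multiplications by powers of 'X,
   the others as d/d'X. *)
Section WeylFunctional.
Variables (K : fieldType) (n l : nat) (e : nat -> nat).
Local Notation A := (free_alg K).

Definition weyl_op x (p : {poly K}) : {poly K} :=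
  if (x < l)%N then 'X^(e x) * p else p^`().

Definition weyl_act (w : seq nat) p := foldr weyl_op p w.

Lemma weyl_act_cat u v p : weyl_act (u ++ v) p = weyl_act u (weyl_act v p).
Proof. exact: foldr_cat. Qed.

Lemma weyl_act_linear w c p q :
  weyl_act w (c *: p + q) = c *: weyl_act w p + weyl_act w q.
Proof.
elim: w => //= x w ->; rewrite /weyl_op; case: ifP => _.
  by rewrite mulrDr scalerAr.
by rewrite derivD derivZ.
Qed.

Lemma weyl_act_sub w : submorph (weyl_act w).
Proof. by move=> p q; rewrite addrC -scaleN1r weyl_act_linear scaleN1r addrC. Qed.

Lemma diffop_weyl_act w : diffop (count (fun x => l <= x)%N w).+1 (weyl_act w).
Proof.
elim: w => [|x w IH].
  by move=> q p; rewrite /= subrr.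
rewrite /= /weyl_op ltnNge; case: (l <= x)%N => /=.
  exact: (diffop_deriv IH).
exact: (diffop_mull _ IH).
Qed.

Definition weyl f p : {poly K} := lext (fun w => weyl_act w p) (f : A).

Lemma weyl_word w p : weyl (word K w) p = weyl_act w p.
Proof. exact: lext_word. Qed.

Lemma weylP c f g p : weyl (c *: f + g) p = c *: weyl f p + weyl g p.
Proof. exact: linearP. Qed.

Lemma weyl0 p : weyl 0 p = 0.
Proof. exact: linear0. Qed.

Lemma weyl_linear f c p q : weyl f (c *: p + q) = c *: weyl f p + weyl f q.
Proof.
move: f; apply: malg_word_ind => [w|]; first by rewrite !weyl_word weyl_act_linear.
split=> [|a f g fE gE]; first by rewrite !weyl0 scaler0 addr0.
rewrite !weylP fE gE !scalerDr !scalerA (mulrC a c) addrACA.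
by [].
Qed.

Lemma weyl_sub f : submorph (weyl f).
Proof. by move=> p q; rewrite addrC -scaleN1r weyl_linear scaleN1r addrC. Qed.

Lemma weyl_mulr f v p : weyl (f * word K v) p = weyl f (weyl_act v p).
Proof.
move: f; apply: malg_word_ind => [w|].
  by rewrite -word_cat !weyl_word weyl_act_cat.
split=> [|a f g fE gE]; first by rewrite mul0r !weyl0.
have -> : (a *: f + g) * word K v = a *: (f * word K v) + g * word K v.
  by rewrite mulrDl -scalerAl.
by rewrite [LHS]weylP [RHS]weylP; congr (_ *: _ + _).
Qed.

Lemma weyl_mull f v p : weyl (word K v * f) p = weyl_act v (weyl f p).
Proof.
move: f; apply: malg_word_ind => [w|].
  by rewrite -word_cat !weyl_word weyl_act_cat.
split=> [|a f g fE gE].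
  by rewrite mulr0 !weyl0 (submorph0 (weyl_act_sub v)).
have -> : word K v * (a *: f + g) = a *: (word K v * f) + word K v * g.
  by rewrite mulrDr -malg_scalerAr.
have -> : weyl (a *: f + g) p = a *: weyl f p + weyl g p by exact: weylP.
by rewrite [LHS]weylP [RHS]weyl_act_linear; congr (_ *: _ + _).
Qed.

Lemma weyl_comm f v p :
  weyl (comm f (word K v)) p = weyl f (weyl_act v p) - weyl_act v (weyl f p).
Proof.
have -> : comm f (word K v) = (-1) *: (word K v * f) + f * word K v.
  by rewrite scaleN1r addrC.
rewrite [LHS]weylP [RHS]addrC scaleN1r; congr (- _ + _); [exact: weyl_mull | exact: weyl_mulr].
Qed.

Local Notation order w := (count (fun x => l <= x)%N w).

Lemma weyl_foldl_comm0 f (ws : seq (seq nat)) : (forall p, weyl f p = 0) ->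
  forall p, weyl (foldl (@comm A) f (map (word K) ws)) p = 0.
Proof.
elim: ws f => //= w ws IH f f0; apply: IH => p.
by rewrite weyl_comm !f0 (submorph0 (weyl_act_sub w)) subr0.
Qed.

(** Commuting with a word raises the order by at most the number of derivations in it minus one. *)
Lemma diffop_foldl_comm m f (ws : seq (seq nat)) : diffop m (weyl f) ->
  diffop (m + order (flatten ws) - size ws)
    (weyl (foldl (@comm A) f (map (word K) ws))).
Proof.
elim: ws m f => [|w ws IH] m f fm; first by rewrite addn0 subn0.
(* The zero operator stays zero; it is set apart since [diffop_comm] needs successors. *)
case: m fm => [f0|m fm]; first by apply: diffop0; apply: weyl_foldl_comm0.
rewrite /= count_cat addnA addSn addSn subSS; apply: IH.
apply: (diffop_ext (D := fun p => weyl f (weyl_act w p) - weyl_act w (weyl f p))).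
  by move=> p; rewrite weyl_comm.
apply: diffop_comm => //; [exact: weyl_sub | exact: weyl_act_sub | exact: diffop_weyl_act].
Qed.

Lemma weyl_lncomm0 w (ws : seq (seq nat)) p :
  (order (flatten (w :: ws)) < size ws)%N -> weyl (lncomm (map (word K) (w :: ws))) p = 0.
Proof.
move=> lt; suff : diffop 0 (weyl (lncomm (map (word K) (w :: ws)))) by apply.
have /(diffop_foldl_comm ws) : diffop (order w).+1 (weyl (word K w)).
  by apply: diffop_ext (diffop_weyl_act w) => q; rewrite weyl_word.
move: lt; rewrite /= count_cat => lt.
by have /eqP -> : ((order w).+1 + order (flatten ws) - size ws == 0)%N by rewrite subn_eq0.
Qed.

Definition weyl_coef (w : seq nat) : K^o :=
  if perm_eq w (iota 0 n) then (weyl_act w 1)`_0 else 0.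

Definition weylf : {linear A -> K^o} := lext weyl_coef.

Lemma weylf_word w :
  weylf (word K w) = weyl_coef w.
Proof. exact: lext_word. Qed.

Lemma weylf_perm w f : supp_in (perm_eq w) f ->
  weylf f = if perm_eq w (iota 0 n) then (weyl f 1)`_0 else 0.
Proof.
move=> wf; transitivity (\sum_(m <- msupp f) f@_m *: weyl_coef m); first by [].
rewrite big_seq (eq_bigr (fun m : {fmonom nat} =>
    f@_m * (if perm_eq w (iota 0 n) then (weyl_act m 1)`_0 else 0))) => [|m mf].
  rewrite -big_seq; case: ifP => _; last by rewrite big1 // => m _; rewrite mulr0.
  by rewrite /weyl /lext coef_sum; apply: eq_bigr => m _; rewrite coefZ.
by rewrite /weyl_coef -(permPl (wf m mf)).
Qed.

(** A commutator of [q.+2] words commutes [q.+1] times, but at most [q] derivations are available,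
    so its order bound drops to zero. *)
Lemma weylf_kill q f : (order (iota 0 n) <= q)%N -> comm_ideal q.+2 f -> weylf f = 0.
Proof.
move=> oq; move: f; apply: comm_ideal_kill => u [|w ws] v // [sz].
rewrite (weylf_perm (w := u ++ flatten (w :: ws) ++ v)); last first.
  rewrite -mulrA; apply: supp_in_permM; first exact: supp_in_word.
  by apply: supp_in_permM; [apply: supp_in_perm_lncomm | apply: supp_in_word].
case: ifP => // pw; rewrite weyl_mulr weyl_mull weyl_lncomm0.
  by rewrite (submorph0 (weyl_act_sub u)) coef0.
rewrite sz ltnS; apply: leq_trans oq; rewrite -(permP pw) !count_cat.
by rewrite addnCA leq_addr.
Qed.

(** A positive power of 'X on the left kills the constant term; hence [proj] does not change
    [weylf]. *)
Lemma weylf_mull x f : (x < l)%N -> (0 < e x)%N -> weylf (word K [:: x] * f) = 0.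
Proof.
move=> xl ex; move: f; apply: (@malg_word_ind _ (fun f => weylf (word K [:: x] * f) = 0)).
  move=> w; rewrite -word_cat weylf_word /weyl_coef; case: ifP => //= _.
  by rewrite /weyl_op xl coefXnM ex.
exact: (linear_eq0_subspace (weylf \o lmull (word K [:: x]))).
Qed.

Lemma weyl_act_low s p : all (fun x => x < l)%N s ->
  weyl_act s p = 'X^(sumn (map e s)) * p.
Proof.
elim: s => [|x s IH] /=; first by rewrite expr0 mul1r.
by case/andP => xl /IH ->; rewrite /weyl_op xl exprD mulrA.
Qed.

(** Each commutation sends c 'X^(m+1) to -c (m+1) 'X^m, and the factor m+1 is nonzero in
    characteristic 0. *)
Lemma weyl_foldl_deriv (charK0 : [pchar K] =i pred0) s f c :
  all (fun x => l <= x)%N s -> c != 0 ->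
  (forall p, weyl f p = c *: 'X^(size s) * p) ->
  exists2 d, d != 0 & forall p,
    weyl (foldl (@comm A) f (map (fun x => word K [:: x]) s)) p = d *: p.
Proof.
elim: s f c => [|x s IH] f c /=.
  by move=> _ c0 fE; exists c => // p; rewrite fE expr0 -scalerAl mul1r.
case/andP => lx ls c0 fE; apply: (IH _ (- (c * (size s).+1%:R))) => // [|p].
  by rewrite oppr_eq0 mulf_neq0 // ((pcharf0P K).1 charK0).
rewrite weyl_comm !fE /= /weyl_op ltnNge lx /= -!mul_polyC !derivM derivC derivXn /=.
rewrite polyCN polyCM polyC_natr -mulr_natr; ring.
Qed.

End WeylFunctional.

(** * Proper components *)

Section EraseLetter.
Variables (K : fieldType) (x : nat).
Local Notation A := (free_alg K).

(* The substitution of 1 for the variable x. *)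
Definition erase : {linear A -> A} := lext (fun w => word K (filter (predC1 x) w)).

Lemma erase_word w : erase (word K w) = word K (filter (predC1 x) w).
Proof. exact: lext_word. Qed.

Lemma eraseM f g : erase (f * g) = erase f * erase g.
Proof.
move: f; apply: (linear_word_eq (phi := erase \o lmulr g)
  (psi := lmulr (erase g) \o erase)) => u /=.
move: g; apply: (linear_word_eq (phi := erase \o lmull (word K u))
  (psi := lmull (erase (word K u)) \o erase)) => v /=.
by rewrite /lmull !erase_word -word_cat -word_cat erase_word filter_cat.
Qed.

Lemma erase1 : erase 1 = 1.
Proof. by rewrite -word_nil erase_word. Qed.

Lemma erase_comm f g : erase (comm f g) = comm (erase f) (erase g).
Proof.
exact: (etrans (linearB erase (f * g) (g * f))
  (congr2 (fun a b => a - b) (eraseM f g) (eraseM g f))).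
Qed.

Lemma erase_var y : erase (var K y) = if y == x then 1 else var K y.
Proof. by rewrite -word1 erase_word /=; case: eqP => //= _; rewrite word_nil. Qed.

Lemma erase_lncomm us : erase (lncomm us) = lncomm (map erase us).
Proof. by apply: lncomm_morph; [exact: erase_comm | exact: linear0]. Qed.

Lemma erase_comm_ideal q f : comm_ideal q f -> comm_ideal q (erase f).
Proof.
have [s0 s1] := comm_ideal_subspace K q.
move: f; apply: (@comm_ideal_ind K (fun f => comm_ideal q (erase f))).
  by split=> [|c f g Pf Pg]; [rewrite linear0 | rewrite linearP; exact: (s1 _ _ _ Pf Pg)].
move=> f us g sz; rewrite !eraseM erase_lncomm.
by apply: comm_ideal_gen; rewrite size_map.
Qed.

Definition proj f : A := f - var K x * erase f.

Lemma proj_comm_ideal q f : comm_ideal q f -> comm_ideal q (proj f).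
Proof.
move=> If; apply: (subspaceB (comm_ideal_subspace K q)) => //.
by rewrite -[_ * _]mulr1; apply: comm_idealM; apply: erase_comm_ideal.
Qed.

Lemma proj_is_linear : linear proj.
Proof.
move=> c f g; rewrite /proj linearP /= scalerBr malg_scalerAr -addrACA -opprD.
by rewrite -mulrDr.
Qed.
HB.instance Definition _ := GRing.isLinear.Build K A A _ proj proj_is_linear.

Lemma erase_prod (ss : seq (seq nat)) : erase (\prod_(s <- ss) lncomm (map (var K) s)) =
  \prod_(s <- ss) erase (lncomm (map (var K) s)).
Proof. by apply: big_morph; [exact: eraseM | exact: erase1]. Qed.

Lemma erase_lncomm_var s : x \notin s ->
  erase (lncomm (map (var K) s)) = lncomm (map (var K) s).
Proof.
move=> xs; rewrite erase_lncomm -map_comp; congr lncomm.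
apply/eq_in_map => y ys /=; rewrite erase_var; case: eqP => // e.
by rewrite -e ys in xs.
Qed.

Lemma erase_lncomm_var0 s : (1 < size s)%N -> x \in s ->
  erase (lncomm (map (var K) s)) = 0.
Proof.
move=> s1 xs; rewrite erase_lncomm lncomm_has1 ?size_map //.
rewrite -map_comp; apply/mapP; exists x => //=.
by rewrite erase_var eqxx.
Qed.

End EraseLetter.

Section AlmostProper.
Variable K : fieldType.
Local Notation A := (free_alg K).
Local Notation lcprod ss := (\prod_(s <- ss) lncomm (map (var K) s)).

(* Multilinear products, in the letters of w, of single letters from S and of
   commutators of letters. *)
Definition almost_proper (w S : seq nat) : A -> Prop :=
  lspan (fun f => exists ss : seq (seq nat), [/\ perm_eq (flatten ss) w,
    all (fun s => (1 < size s)%N || (size s == 1%N) && (head 0%N s \in S)) ss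
    & f = lcprod ss]).

Lemma almost_proper_subspace w S : subspace (almost_proper w S).
Proof. exact: lspan_subspace. Qed.

Lemma almost_proper_incl w S ss : perm_eq (flatten ss) w ->
  all (fun s => (1 < size s)%N || (size s == 1%N) && (head 0%N s \in S)) ss ->
  almost_proper w S (lcprod ss).
Proof. by move=> pw a; apply: lspan_incl; exists ss. Qed.

Lemma almost_proper_perm w w' S f : perm_eq w w' ->
  almost_proper w S f -> almost_proper w' S f.
Proof.
move=> pw; move: f; apply: lspan_ind; first exact: almost_proper_subspace.
move=> _ [ss [pss a ->]]; apply: almost_proper_incl => //.
exact: perm_trans pss pw.
Qed.

Lemma almost_properM w w' S f g : almost_proper w S f -> almost_proper w' S g ->
  almost_proper (w ++ w') S (f * g).
Proof.
apply: lspanM => [c x y|x y [ss [p a ->]] [ss' [p' a' ->]]]; first exact: malg_scalerAr.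
by exists (ss ++ ss'); rewrite flatten_cat perm_cat // all_cat a a' big_cat.
Qed.

Lemma almost_proper_lcomm w S s : perm_eq s w -> (1 < size s)%N ->
  almost_proper w S (lncomm (map (var K) s)).
Proof.
move=> pw s1; have := @almost_proper_incl w S [:: s].
by rewrite big_seq1 /= cats0 s1; apply.
Qed.

(** By the Leibniz rule [x] is appended to one factor at a time, lengthening a commutator or turning
    a bare letter into a commutator of length 2. *)
Lemma almost_proper_comm w S x f :
  almost_proper w S f -> almost_proper (rcons w x) S (comm f (var K x)).
Proof.
move: f; apply: lspan_ind.
  have [s0 s1] := almost_proper_subspace (rcons w x) S.
  split=> [|c f g Pf Pg].
    by have -> : comm 0 (var K x) = 0 :> A by exact: comm0l.
  by rewrite (commDZl c f g); exact: (s1 _ _ _ Pf Pg).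
move=> _ [ss [pss a ->]].
suff : almost_proper (rcons (flatten ss) x) S (comm (lcprod ss) (var K x)).
  by apply: almost_proper_perm; rewrite -!cats1 perm_cat2r.
elim: ss a {w pss} => [_|s ss IH /= /andP[gs gss]].
  by rewrite big_nil comm1l; apply: (almost_proper_subspace _ _).1.
rewrite big_cons comm_mul; apply: (subspaceD (almost_proper_subspace _ _)).
  rewrite -cats1 -catA cats1; apply: almost_properM (IH gss).
  have := @almost_proper_incl s S [:: s].
  by rewrite big_seq1 /= cats0 gs; apply.
apply: (@almost_proper_perm (rcons s x ++ flatten ss)).
  by rewrite -!cats1 -!catA perm_cat2l perm_catC.
apply: almost_properM; last exact: almost_proper_incl.
have sn : s != [::] by case: (s) gs.
rewrite -lncomm_rcons; last by case: (s) sn.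
rewrite -map_rcons; apply: almost_proper_lcomm => //.
by rewrite size_rcons ltnS; case: (s) sn.
Qed.

(** If [x] lies inside a commutator, setting it to 1 gives 0 and the product is unchanged; if it is
    bare, [comm_pull] replaces a x b by [a, x] b. *)
Lemma almost_proper_proj w S x f : uniq w -> x \in w ->
  almost_proper w S f -> almost_proper w (filter (predC1 x) S) (proj x f).
Proof.
move=> uw xw; move: f; apply: (@lspan_ind _ _ _ (fun f => almost_proper w _ (proj x f))).
  have [s0 s1] := almost_proper_subspace w (filter (predC1 x) S).
  by split=> [|c f g Pf Pg]; [rewrite linear0 | rewrite linearP; exact: (s1 _ _ _ Pf Pg)].
move=> _ [ss [pss a ->]]; rewrite /proj.
have good s : [:: x] != s -> (1 < size s)%N || (size s == 1%N) && (head 0%N s \in S) ->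
    (1 < size s)%N || (size s == 1%N) && (head 0%N s \in filter (predC1 x) S).
  case: s => [|y [|z s]] //= ne yS; rewrite mem_filter yS andbT /=.
  by apply: contraNneq ne => ->.
have [xss|xss] := boolP ([:: x] \in ss); last first.
  have -> : erase K x (lcprod ss) = 0.
    have : x \in flatten ss by rewrite (perm_mem pss).
    case/flattenP => s sss xs; have s1 : (1 < size s)%N.
      have := allP a _ sss; case: s sss xs => [|y [|z s]] //= sss.
      by rewrite inE => /eqP xy; rewrite -xy in sss; rewrite sss in xss.
    have e0 := erase_lncomm_var0 K s1 xs.
    rewrite erase_prod; case/splitPr: sss => ss1 ss2; rewrite big_cat big_cons /=.
    by rewrite e0 mul0r mulr0.
  rewrite mulr0 subr0; apply: almost_proper_incl => //.
  apply/allP => s sss; apply: good; last exact: (allP a).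
  by apply: contraNneq xss => ->.
case/splitPr: xss pss a => ss1 ss2 pss.
rewrite all_cat /= => /and3P[a1 _ a2].
have u : uniq (flatten ss1 ++ x :: flatten ss2).
  by rewrite -(perm_uniq pss) flatten_cat /= in uw *.
have {u}[x1 x2] : x \notin flatten ss1 /\ x \notin flatten ss2.
  by move: u; rewrite cat_uniq /= negb_or => /and3P[_ /andP[-> _] /andP[-> _]].
have prodE ss' : x \notin flatten ss' -> erase K x (lcprod ss') = lcprod ss'.
  move=> xs; rewrite erase_prod; apply: eq_big_seq => s sss.
  by apply: erase_lncomm_var; apply: contra xs => xs; apply/flattenP; exists s.
have apE ss' : x \notin flatten ss' ->
    all (fun s => (1 < size s)%N || (size s == 1%N) && (head 0%N s \in S)) ss' ->
    almost_proper (flatten ss') (filter (predC1 x) S) (lcprod ss').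
  move=> xs as'; apply: almost_proper_incl => //.
  apply/allP => s sss; apply: good; last exact: (allP as').
  apply: contraNneq xs => e; apply/flattenP; exists s => //.
  by rewrite -e mem_head.
have -> : lcprod (ss1 ++ [:: x] :: ss2) = lcprod ss1 * var K x * lcprod ss2.
  by rewrite big_cat big_cons /= mulrA.
rewrite !eraseM (prodE _ x1) (prodE _ x2) erase_var eqxx mulr1 comm_pull.
apply: (@almost_proper_perm (rcons (flatten ss1) x ++ flatten ss2)).
  by rewrite cat_rcons; move: pss; rewrite flatten_cat.
apply: almost_properM; last exact: apE.
by apply: almost_proper_comm; apply: apE.
Qed.

Lemma almost_proper_foldl_proj w S xs f : uniq w -> {subset xs <= w} ->
  almost_proper w S f -> almost_proper w (filter (fun y => y \notin xs) S) (foldr (@proj K) f xs).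
Proof.
move=> uw; elim: xs => [|x xs IH] /= xsw Sf.
  by rewrite filter_predT.
rewrite (eq_filter (a2 := predI (predC1 x) (fun y => y \notin xs))) => [|y]; last first.
  by rewrite /= inE negb_or.
rewrite filter_predI; apply: almost_proper_proj => //; first by apply: xsw; rewrite mem_head.
by apply: IH => // y yxs; apply: xsw; rewrite inE yxs orbT.
Qed.

Lemma almost_proper_nil n f :
  almost_proper (iota 0 n) [::] f -> proper_multilinear n f.
Proof.
move: f; apply: lspan_ind.
  split=> [|c f g [mf pf] [mg pg]].
    by split; [exact: (multilinear_subspace _ _).1 | exact: (proper_subspace _).1].
  by split; [apply: (multilinear_subspace _ _).2 | apply: (proper_subspace _).2].
move=> _ [ss [pss a ->]]; split.
  apply/multilinearP; apply: (supp_in_perm pss).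
  elim: ss {pss a} => [|s ss IH]; first by rewrite big_nil; apply: supp_in_perm1.
  rewrite big_cons /=; apply: supp_in_permM => //.
  by rewrite -lcomm_var; apply: supp_in_lcomm.
apply: lspan_incl; exists ss; split=> //.
by apply: sub_all a => s; rewrite andbF orbF.
Qed.

Lemma almost_proper_word s : almost_proper s s (word K s).
Proof.
have -> : word K s = lcprod [seq [:: x] | x <- s].
  elim: s => [|x s IH]; first by rewrite big_nil word_nil.
  by rewrite -cat1s word_cat IH /= big_cons word1.
apply: almost_proper_incl; first by rewrite flatten_seq1.
by apply/allP => _ /mapP[x xs ->].
Qed.

Lemma almost_proper_foldl_comm w S s f : almost_proper w S f ->
  almost_proper (w ++ s) S (foldl (@comm A) f (map (fun x => word K [:: x]) s)).
Proof.
elim: s w f => [|x s IH] w f wf /=; first by rewrite cats0.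
by rewrite -cat_rcons; apply: IH; rewrite word1; apply: almost_proper_comm.
Qed.

End AlmostProper.

(** * A proper polynomial separating consecutive identities *)

Section Strictness.
Variables (K : fieldType) (k n : nat).
Hypothesis charK0 : [pchar K] =i pred0.
Hypothesis n_gt : (2 * k < n)%N.
Hypothesis n_le : (n <= 4 * k)%N.

(* [x_1 ... x_l, x_(l+1), ..., x_n] is made proper by the projections f - x f(x := 1),
   which do not change the constant term of its image under x_1 |-> t^(2k-l+1),
   x_2, ..., x_l |-> t, x_(l+1), ..., x_n |-> d/dt. *)
Lemma strict_witness : exists f : free_alg K,
  [/\ proper_multilinear n f, comm_ideal (2 * k).+1 f & ~ comm_ideal (2 * k).+2 f].
Proof.
pose l := (n - 2 * k)%N; have nE : n = (l + 2 * k)%N by rewrite /l; lia.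
have l0 : (0 < l)%N by rewrite /l; lia.
have lk : (l <= 2 * k)%N by rewrite /l; lia.
(* The exponents add up to 2k, so that the 2k derivations leave exactly a constant. *)
pose e x := if x == 0%N then (2 * k - l.-1)%N else 1%N.
(* The first exponent is positive because [l] is at most 2k, which is where [n <= 4 * k] enters. *)
have e0 x : (x < l)%N -> (0 < e x)%N by rewrite /e; case: eqP; lia.
pose f := foldl (@comm (free_alg K)) (word K (iota 0 l))
  (map (fun x => word K [:: x]) (iota l (2 * k))).
pose g := foldr (@proj K) f (iota 0 l).
have wE : iota 0 l ++ iota l (2 * k) = iota 0 n by rewrite nE iotaD.
exists g; split.
- apply: almost_proper_nil.
  have := @almost_proper_foldl_proj K (iota 0 n) (iota 0 l) (iota 0 l) f (iota_uniq _ _).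
  rewrite (eq_in_filter (a2 := pred0)) ?filter_pred0 => [|y -> //]; apply.
    by move=> y; rewrite !mem_iota; lia.
  by rewrite -wE; apply: almost_proper_foldl_comm; apply: almost_proper_word.
- have : comm_ideal (2 * k).+1 f.
    rewrite -[f]mulr1 -[f]mul1r.
    have := @comm_ideal_gen K (2 * k).+1 1 (word K (iota 0 l) ::
      map (fun x => word K [:: x]) (iota l (2 * k))) 1.
    by apply; rewrite /= size_map size_iota.
  rewrite /g; elim: (iota 0 l) => //= x s IH /IH; exact: proj_comm_ideal.
move=> gI; have : weylf K n l e g = 0.
  apply: weylf_kill gI; rewrite -wE count_cat.
  rewrite (eq_in_count (a2 := pred0)) => [|y]; last by rewrite mem_iota /=; lia.
  by rewrite count_pred0 add0n (leq_trans (count_size _ _)) // size_iota.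
(* Each projection subtracts a multiple of a letter on the left, where [weylf] vanishes. *)
have -> : weylf K n l e g = weylf K n l e f.
  rewrite /g; have : {subset iota 0 l <= iota 0 l} by [].
  elim: {1 3}(iota 0 l) => //= x s IH xs; rewrite /proj linearB /=.
  have xl : (x < l)%N by have := xs x (mem_head _ _); rewrite mem_iota.
  rewrite -word1 weylf_mull ?e0 // subr0; apply: IH => y ys.
  by apply: xs; rewrite inE ys orbT.
rewrite (@weylf_perm K n l e (iota 0 n)); last first.
  have := @supp_in_perm_lncomm K (iota 0 l :: [seq [:: x] | x <- iota l (2 * k)]).
  by rewrite /= flatten_seq1 wE -map_comp.
rewrite perm_refl.
have sumE : sumn (map e (iota 0 l)) = (2 * k)%N.
  case: (l) l0 lk @e {e0} => // l' _ lk /=.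
  have : forall m a, sumn (map (fun x => if x == 0%N then (2 * k - l')%N else 1%N) (iota a.+1 m)) = m.
    by elim=> //= m IH a; rewrite IH.
  by move=> ->; lia.
have low : all (fun x => x < l)%N (iota 0 l) by apply/allP => x; rewrite mem_iota.
have high : all (fun x => l <= x)%N (iota l (2 * k)).
  by apply/allP => x; rewrite mem_iota => /andP[].
have fE p : weyl l e (word K (iota 0 l)) p = 1 *: 'X^(size (iota l (2 * k))) * p.
  by rewrite weyl_word weyl_act_low // sumE size_iota scale1r.
have [d d0 dE] := weyl_foldl_deriv charK0 high (oner_neq0 _) fE.
rewrite dE -[d *: 1]mul_polyC mulr1 coefC eqxx => /eqP.
by rewrite (negbTE d0).
Qed.

End Strictness.

(** * Main theorem *)

Section Monotonicity.
Variables (K : fieldType) (p n : nat).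

Lemma lie_nilp_idsS f : lie_nilp_ids (K := K) p.+1 n f -> lie_nilp_ids p n f.
Proof. by case=> /comm_idealS If Sf; split=> //; apply: If. Qed.

Lemma leq_codimS : (codim K p n <= codim K p.+1 n)%N.
Proof.
apply: (dim_modS (@lie_nilp_ids_subspace K p n) (@lie_nilp_ids_subspace K p.+1 n)).
  exact: lie_nilp_idsS.
by move=> f; apply: multilinear_in_span_mod.
Qed.

Lemma leq_proper_codimS : (proper_codim K p n <= proper_codim K p.+1 n)%N.
Proof.
apply: (dim_modS (@lie_nilp_ids_subspace K p n) (@lie_nilp_ids_subspace K p.+1 n)).
  exact: lie_nilp_idsS.
by move=> f [mf _]; apply: multilinear_in_span_mod.
Qed.

Lemma ltn_codimS f : proper_multilinear (K := K) n f ->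
  comm_ideal p.+1 f -> ~ comm_ideal p.+2 f ->
  (codim K p n < codim K p.+1 n)%N /\ (proper_codim K p n < proper_codim K p.+1 n)%N.
Proof.
move=> pf If nIf; have [mf _] := pf.
have Wf : lie_nilp_ids p n f by apply: multilinear_lie_nilp_ids.
have nWf : ~ lie_nilp_ids p.+1 n f by case.
split; apply: (dim_mod_lt (@lie_nilp_ids_subspace K p n)
  (@lie_nilp_ids_subspace K p.+1 n) (@lie_nilp_idsS) _ _ Wf nWf) => //.
  by move=> g; apply: multilinear_in_span_mod.
by move=> g [mg _]; apply: multilinear_in_span_mod.
Qed.

End Monotonicity.

Theorem corollary3p7 (K : fieldType) (charK0 : [pchar K] =i pred0)
    (k : nat) (k_ge1 : (1 <= k)%N) :
  (* (i) *)
  ((forall n : nat, (2 * k <= n)%N ->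
      (proper_codim K (2 * k) n <= proper_codim K (2 * k + 1) n)%N) /\
   (exists p : {poly rat},
      [/\ size p = (2 * k - 2).+1,
          lead_coef p = (2 : rat) ^ ((2 * k)%:Z - 3) / ((2 * k - 2)`!)%:R
        & forall n : nat, (2 * k <= n)%N -> (2 <= k)%N || ~~ odd n ->
            p.[n%:R] <= (proper_codim K (2 * k) n)%:R])) /\
  (* (ii) *)
  ((forall n : nat, (codim K (2 * k) n <= codim K (2 * k + 1) n)%N) /\
   (exists xi eta : {poly rat},
      [/\ size xi = (2 * k - 2).+1,
          lead_coef xi = (((2 * k - 2)`!)%:R)^-1,
          (size eta <= (2 * k - 1).+1)%N
        & forall n : nat,
            (2 : rat) ^ (n%:Z - 1) * xi.[n%:R] + eta.[n%:R]
              <= (codim K (2 * k) n)%:R])) /\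
  (* strictness *)
  (forall n : nat, (2 * k < n)%N -> (n <= 4 * k)%N ->
     (codim K (2 * k) n < codim K (2 * k + 1) n)%N /\
     (proper_codim K (2 * k) n < proper_codim K (2 * k + 1) n)%N).
Proof.
have two_neq0 : 2 != 0 :> K by rewrite ((pcharf0P K).1 charK0).
(* The number of generators of the second Grassmann factor; it is 0 exactly when [k = 1]. *)
pose r := (2 * k - 2)%N.
have kr : (2 * k = r.+2)%N by rewrite /r; lia.
have r_even : ~~ odd r by rewrite /r; lia.
split; last split.
- split=> [n _|]; first by rewrite addn1; apply: leq_proper_codimS.
  have [p [sp lp pn]] := proper_codim_lower_bound two_neq0 r_even.
  exists p; rewrite -/r kr; split; first exact: sp.
    by rewrite lp; congr (_ ^ _ / _); lia.
  by move=> n n_ge nk; apply: pn => //; move: nk; rewrite /r; lia.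
- split=> [n|]; first by rewrite addn1; apply: leq_codimS.
  have [xi [eta [sx lx se bound]]] := codim_lower_bound two_neq0 r_even.
  by exists xi, eta; rewrite -/r kr subn1.
move=> n n_gt n_le; rewrite addn1.
have [f [pf If nIf]] := strict_witness charK0 n_gt n_le.
exact: ltn_codimS pf If nIf.
Qed.
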